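(* Let $\sigma>0$, let $X$ be the closed unit ball of the Euclidean space $\mathbb{R}^d$, $Y=\{-1,1\}$, and let $P$ be a probability measure on $X\times Y$ that has geometric noise exponent $0<\alpha<\infty$ with constant $C$, i.e. $$\int_X|2\eta(x)-1|\exp\Big(-\frac{\tau_x^2}{t}\Big)P_X(dx)\le Ct^{\alpha d/2}\qquad\text{for all }t>0.$$ Let $a_\sigma(\cdot)$ be the approximation error function with respect to $H_\sigma(X)$ and $P$. Then there is a constant $c_d>0$ depending only on the dimension $d$ such that for all $\lambda>0$ we have $$a_\sigma(\lambda)\le c_d\big(\sigma^d\lambda+C(2d)^{\alpha d/2}\sigma^{-\alpha d}\big).$$
   Context: $P_X$ is the marginal of $P$ on $X$ and $\eta(x):=P(y=1|x)$ is a fixed version of the conditional probability. Let $X_{-1}:=\{\eta<\frac12\}$, $X_1:=\{\eta>\frac12\}$, $X_0:=\{\eta=\frac12\}$, and let $\tau_x:=d(x,X_0\cup X_1)$ if $x\in X_{-1}$, $\tau_x:=d(x,X_0\cup X_{-1})$ if $x\in X_1$, and $\tau_x:=0$ otherwise, where $d(x,A)$ is the Euclidean distance of $x$ to the set $A$. $H_\sigma(X)$ is the reproducing kernel Hilbert space of the Gaussian RBF kernel $k_\sigma(x,x')=\exp(-\sigma^2\|x-x'\|_2^2)$ on $X$. The hinge loss is $l(y,t):=\max\{0,1-yt\}$; for measurable $f:X\to\mathbb{R}$, $\mathcal{R}_{l,P}(f):=\mathbb{E}_{(x,y)\sim P}\,l(y,f(x))$, and $\mathcal{R}_{l,P}:=\inf\{\mathcal{R}_{l,P}(f):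 f:X\to\mathbb{R}\text{ measurable}\}$. The approximation error function is $a_\sigma(\lambda):=\inf_{f\in H_\sigma(X)}\big(\lambda\|f\|_{H_\sigma(X)}^2+\mathcal{R}_{l,P}(f)-\mathcal{R}_{l,P}\big)$.
   Formalization: The distance to the empty set, left undefined, is taken as 0; this matters only if η>1/2 everywhere or η<1/2 everywhere on X, which for d≥1 the noise condition then excludes; with distance +∞ the claim fails (η=1, P_X a point mass at 0, σ→0). *)

(* Defs.v *)
From HB Require Import structures.
From mathcomp Require Import all_boot all_order all_algebra.
From mathcomp Require Import all_classical all_reals all_analysis.
Import Order.TTheory GRing.Theory Num.Theory.
Import numFieldNormedType.Exports.

Set Implicit Arguments.
Unset Strict Implicit.
Unset Printing Implicit Defensive.

Local Open Scope classical_set_scope.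
Local Open Scope ring_scope.

(* The norm `|x| that the library puts on 'rV[R]_d is the sup norm. *)
Definition enorm (R : realType) (d : nat) (x : 'rV[R]_d) : R :=
  Num.sqrt (\sum_(i < d) x ord0 i ^+ 2).

Lemma enorm0 (R : realType) (d : nat) : enorm (0 : 'rV[R]_d) <= 1.
Proof.
rewrite /enorm big1 ?sqrtr0 ?ler01// => i _.
by rewrite mxE expr0n.
Qed.

Definition uball (R : realType) (d : nat) : Type :=
  {x : 'rV[R]_d | enorm x <= 1}.

HB.instance Definition _ (R : realType) (d : nat) := Choice.on (uball R d).
HB.instance Definition _ (R : realType) (d : nat) :=
  isPointed.Build (uball R d) (exist _ 0 (enorm0 R d)).

Definition borel_rV (R : realType) (d : nat) :=
  g_sigma_algebraType (@open 'rV[R]_d).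

Definition uball_val (R : realType) (d : nat) (x : uball R d) : borel_rV R d :=
  sval x.

(* The closed Euclidean unit ball, with the traces of the Borel sets. *)
Definition eball (R : realType) (d : nat) :=
  g_sigma_algebra_preimageType (@uball_val R d).

Definition eucl_dist (R : realType) (d : nat) (x y : eball R d) : R :=
  enorm ((sval x : 'rV[R]_d) - sval y).

(* inf set0 = 0, so the distance to the empty set is 0. The convention +oo would
   make the approximation bound false for small sigma: for eta = 1 everywhere,
   the noise condition would hold with every C > 0. *)
Definition dist_set (R : realType) (d : nat) (x : eball R d)
  (A : set (eball R d)) : R := inf [set eucl_dist x a | a in A].

(* Labels: true stands for 1 and false for -1. *)
Definition label (R : realType) (y : bool) : R := if y then 1 else -1.

(* eta is a version of the conditional probability P(y = 1 | x). *)
Definition cond_prob_version (R : realType) (d : nat)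
    (P : probability (eball R d * bool)%type R) (eta : eball R d -> R) : Prop :=
  [/\ measurable_fun setT eta,
      (forall x, 0 <= eta x <= 1) &
      (forall A : set (eball R d), measurable A ->
        P (A `*` [set true]) = \int[pushforward P fst]_(x in A) (eta x)%:E)%E].

Section noise.
Variables (R : realType) (d : nat) (eta : eball R d -> R).

Definition Xneg : set (eball R d) := [set x | eta x < 2^-1].
Definition Xpos : set (eball R d) := [set x | 2^-1 < eta x].
Definition Xzero : set (eball R d) := [set x | eta x = 2^-1].

Definition tau (x : eball R d) : R :=
  if x \in Xneg then dist_set x (Xzero `|` Xpos)
  else if x \in Xpos then dist_set x (Xzero `|` Xneg)
  else 0.

End noise.

Definition geometric_noise (R : realType) (d : nat)
    (P : probability (eball R d * bool)%type R) (eta : eball R d -> R)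
    (alpha C : R) : Prop :=
  forall t : R, 0 < t ->
    (\int[pushforward P fst]_x
        (`|2 * eta x - 1| * expR (- (tau eta x ^+ 2 / t)))%:E
      <= (C * t `^ (alpha * d%:R / 2))%:E)%E.

(* A Hilbert space of real functions on T: a linear subspace of T -> R with an
   inner product (constrained on the subspace only) for which it is complete. *)
Record hilbertFun (R : realType) (T : Type) := HilbertFun {
  hf_mem : set (T -> R);
  hf_dot : (T -> R) -> (T -> R) -> R;
  hf_mem0 : hf_mem (fun _ => 0);
  hf_memP : forall a f g, hf_mem f -> hf_mem g ->
    hf_mem (fun x => a * f x + g x);
  hf_dotC : forall f g, hf_mem f -> hf_mem g -> hf_dot f g = hf_dot g f;
  hf_dotP : forall a f g h, hf_mem f -> hf_mem g -> hf_mem h ->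
    hf_dot (fun x => a * f x + g x) h = a * hf_dot f h + hf_dot g h;
  hf_dot_ge0 : forall f, hf_mem f -> 0 <= hf_dot f f;
  hf_dot_eq0 : forall f, hf_mem f -> hf_dot f f = 0 -> f = (fun _ => 0);
  hf_complete : forall u : nat -> T -> R, (forall n, hf_mem (u n)) ->
    (forall e : R, 0 < e -> exists N, forall m n, (N <= m)%N -> (N <= n)%N ->
      Num.sqrt (hf_dot (fun x => u m x - u n x) (fun x => u m x - u n x)) < e) ->
    exists2 f, hf_mem f &
      (fun n => Num.sqrt (hf_dot (fun x => u n x - f x) (fun x => u n x - f x)))
        @ \oo --> (0 : R)
}.

Definition hf_norm (R : realType) (T : Type) (H : hilbertFun R T)
  (f : T -> R) : R := Num.sqrt (hf_dot H f f).

(* H is the reproducing kernel Hilbert space of k. By the Moore-Aronszajn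
   theorem, for a positive semidefinite k such an H exists, and its functions
   and their inner products are determined by k. *)
Definition is_rkhs (R : realType) (T : Type) (k : T -> T -> R)
    (H : hilbertFun R T) : Prop :=
  (forall x, hf_mem H (k x)) /\
  (forall f x, hf_mem H f -> f x = hf_dot H f (k x)).

Definition gauss_kernel (R : realType) (d : nat) (sigma : R)
  (x x' : eball R d) : R := expR (- (sigma ^+ 2 * eucl_dist x x' ^+ 2)).

Definition hinge (R : realType) (y t : R) : R := Num.max 0 (1 - y * t).

Section risk.
Variables (R : realType) (d : nat) (P : probability (eball R d * bool)%type R).
Local Open Scope ereal_scope.

Definition risk (f : eball R d -> R) : \bar R :=
  'E_P[fun z => hinge (label R z.2) (f z.1)].

Definition bayes_risk : \bar R :=
  ereal_inf [set risk f | f in [set f | measurable_fun setT f]].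

Definition approx_error (H : hilbertFun R (eball R d)) (lambda : R) : \bar R :=
  ereal_inf [set (lambda * hf_norm H f ^+ 2)%:E + risk f - bayes_risk
            | f in hf_mem H].

End risk.

(* Main.v *)
Require Import Defs.
From HB Require Import structures.
From mathcomp Require Import all_boot all_order all_algebra.
From mathcomp Require Import all_classical all_reals all_analysis.
From mathcomp Require Import measurable_realfun.
From mathcomp Require Import ring lra zify.
Import Order.TTheory GRing.Theory Num.Theory.
Import numFieldNormedType.Exports.
Local Open Scope classical_set_scope.
Local Open Scope ring_scope.

Set Implicit Arguments.
Unset Strict Implicit.
Unset Printing Implicit Defensive.

(* The functions of the Gaussian space H are obtained by smoothing the sign of
   2 eta - 1. Extend this sign radially from the unit ball to the cube
   [-3, 3]^d and by 0 outside, and average it against the Gaussian kernel over a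
   finite grid of mesh 1/(n sigma), with weights normalized so that the total
   mass is at most 1 and tends to 1 as n grows. The resulting f satisfies
   |f| <= 1. All grid points in the open ball of radius tau_x around x carry the
   label of x, so up to an arbitrarily small error |f(x) - sgn(2 eta(x) - 1)| is
   bounded by twice the Gaussian mass outside that ball, which is at most
   c exp(-sigma^2 tau_x^2 / 2). As |f| <= 1, the excess hinge risk of f is at most
   the integral of |2 eta - 1| |f - sgn(2 eta - 1)|, and the noise condition at
   t = 2d / sigma^2 bounds it.
   The squared norm of f is a double sum of kernel values, at most the number of
   grid points in the cube times the weight of one of them, which is of order
   sigma^d. Grid points outside the unit ball are allowed because the restriction
   to the ball of a kernel combination on R^d belongs to H with no larger norm. *)

(** * Combinations of kernel sections *)

Definition kcomb (R : realType) (T : Type) (k : T -> T -> R) (s : seq (R * T))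
  (x : T) : R := \sum_(p <- s) p.1 * k p.2 x.

(** By the reproducing property this is the inner product of [kcomb k s] with [f]; as a finite sum
    it also makes sense for an [f] not yet known to lie in the Hilbert space. *)
Definition kpair (R : realType) (T : Type) (s : seq (R * T)) (f : T -> R) : R :=
  \sum_(p <- s) p.1 * f p.2.

Definition kscale (R : realType) (T : Type) (a : R) (s : seq (R * T)) :=
  [seq (a * p.1, p.2) | p <- s].

Definition psd (R : realType) (T : Type) (k : T -> T -> R) :=
  forall s : seq (R * T), 0 <= kpair s (kcomb k s).

Section kernel_combinations.
Variables (R : realType) (T : Type) (k : T -> T -> R).
Implicit Types (s : seq (R * T)) (f g : T -> R) (a : R).

Lemma kcomb1 a x y : kcomb k [:: (a, x)] y = a * k x y.
Proof. by rewrite /kcomb big_seq1. Qed.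

Lemma kpair1 a x f : kpair [:: (a, x)] f = a * f x.
Proof. by rewrite /kpair big_seq1. Qed.

Lemma kcomb_cat s s' x : kcomb k (s ++ s') x = kcomb k s x + kcomb k s' x.
Proof. by rewrite /kcomb big_cat. Qed.

Lemma kcomb_scale a s x : kcomb k (kscale a s) x = a * kcomb k s x.
Proof.
by rewrite /kcomb big_map mulr_sumr; apply: eq_bigr => p _; rewrite mulrA.
Qed.

Lemma kpair_cat s s' f : kpair (s ++ s') f = kpair s f + kpair s' f.
Proof. by rewrite /kpair big_cat. Qed.

Lemma kpair_scale a s f : kpair (kscale a s) f = a * kpair s f.
Proof.
by rewrite /kpair big_map mulr_sumr; apply: eq_bigr => p _; rewrite mulrA.
Qed.

Lemma kpairD s f g : kpair s (fun x => f x + g x) = kpair s f + kpair s g.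
Proof. by rewrite -big_split; apply: eq_bigr => p _; rewrite mulrDr. Qed.

Lemma kpairZ a s f : kpair s (fun x => a * f x) = a * kpair s f.
Proof. by rewrite mulr_sumr; apply: eq_bigr => p _; rewrite mulrCA. Qed.

Lemma eq_kpair s f g : f =1 g -> kpair s f = kpair s g.
Proof. by move=> fg; apply: eq_bigr => p _; rewrite fg. Qed.

Lemma kpair_kcomb_cat s s' : kpair (s ++ s') (kcomb k (s ++ s')) =
  kpair s (kcomb k s) + kpair s (kcomb k s') +
  (kpair s' (kcomb k s) + kpair s' (kcomb k s')).
Proof.
by rewrite (eq_kpair _ (kcomb_cat s s')) kpairD !kpair_cat; lra.
Qed.

Lemma kpair_kcomb_scale a b s s' :
  kpair (kscale a s) (kcomb k (kscale b s')) = a * b * kpair s (kcomb k s').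
Proof.
by rewrite (eq_kpair _ (kcomb_scale b s')) kpairZ kpair_scale mulrCA mulrA.
Qed.

Lemma kpair_kcombC (k_sym : forall x y, k x y = k y x) s s' :
  kpair s (kcomb k s') = kpair s' (kcomb k s).
Proof.
rewrite /kpair /kcomb; under eq_bigr do rewrite mulr_sumr.
under [RHS]eq_bigr do rewrite mulr_sumr.
rewrite exchange_big; apply: eq_bigr => p _; apply: eq_bigr => q _.
by rewrite k_sym mulrCA.
Qed.

Lemma psd_cauchy_schwarz (k_sym : forall x y, k x y = k y x) s s' : psd k ->
  kpair s (kcomb k s') ^+ 2 <= kpair s (kcomb k s) * kpair s' (kcomb k s').
Proof.
move=> k_psd; set A := kpair s (kcomb k s); set B := kpair s (kcomb k s').
set D := kpair s' (kcomb k s').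
have Q a b : 0 <= a ^+ 2 * A + 2 * (a * b) * B + b ^+ 2 * D.
  have := k_psd (kscale a s ++ kscale b s').
  rewrite kpair_kcomb_cat !kpair_kcomb_scale (kpair_kcombC k_sym s' s).
  by rewrite -/A -/B -/D; congr (_ <= _); ring.
have A0 : 0 <= A := k_psd s.
have D0 : 0 <= D := k_psd s'.
have [AE|A_neq0] := eqVneq A 0.
  have [->|B_neq0] := eqVneq B 0; first by rewrite AE mul0r expr0n.
  have B_gt0 : 0 < B ^+ 2 by rewrite exprn_even_gt0.
  (* With [A = 0] this choice turns the form into [- (D + 2) * B ^+ 4], which is negative. *)
  by have := Q (- (D + 1) * B) (B ^+ 2); rewrite AE; nra.
have A_gt0 : 0 < A by rewrite lt_neqAle eq_sym A_neq0.
have := Q (- B) A.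
have -> : (- B) ^+ 2 * A + 2 * (- B * A) * B + A ^+ 2 * D = A * (A * D - B ^+ 2).
  by ring.
by rewrite pmulr_rge0// subr_ge0.
Qed.

End kernel_combinations.

Section hilbert_functions.
Variables (R : realType) (T : Type) (H : hilbertFun R T).
Implicit Types (f g h : T -> R) (a : R).

Lemma hf_memB f g : hf_mem H f -> hf_mem H g -> hf_mem H (fun x => f x - g x).
Proof.
move=> Hf Hg; have := hf_memP (-1) Hg Hf; congr hf_mem.
by apply/funext => x; rewrite mulN1r addrC.
Qed.

Lemma hf_dot0 h : hf_mem H h -> hf_dot H (fun _ => 0) h = 0.
Proof.
move=> Hh; have := hf_dotP 1 (hf_mem0 H) (hf_mem0 H) Hh.
rewrite (_ : (fun x => _) = (fun _ : T => 0)); last first.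
  by apply/funext => x; rewrite mulr0 addr0.
by move=> ?; lra.
Qed.

Lemma hf_dotB f g h : hf_mem H f -> hf_mem H g -> hf_mem H h ->
  hf_dot H (fun x => f x - g x) h = hf_dot H f h - hf_dot H g h.
Proof.
move=> Hf Hg Hh; rewrite -mulN1r addrC -hf_dotP//; congr hf_dot.
by apply/funext => x; rewrite mulN1r addrC.
Qed.

Lemma hf_dotBB f g : hf_mem H f -> hf_mem H g ->
  hf_dot H (fun x => f x - g x) (fun x => f x - g x) =
  hf_dot H f f - 2 * hf_dot H f g + hf_dot H g g.
Proof.
move=> Hf Hg; have Hfg := hf_memB Hf Hg.
rewrite hf_dotB// (hf_dotC Hf)// (hf_dotC Hg)// !hf_dotB//.
by rewrite (hf_dotC Hg Hf); ring.
Qed.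

End hilbert_functions.

Section rkhs.
Variables (R : realType) (T : Type) (k : T -> T -> R) (H : hilbertFun R T).
Hypothesis Hk : is_rkhs k H.
Implicit Types (s : seq (R * T)) (f g : T -> R).

Lemma rkhs_sym x y : k x y = k y x.
Proof.
case: Hk => kH rep; rewrite (rep (k x) y)// (rep (k y) x)//.
by rewrite (hf_dotC (kH x) (kH y)).
Qed.

Lemma kcomb_mem s : hf_mem H (kcomb k s).
Proof.
elim: s => [|p s IH].
  have := hf_mem0 H; congr hf_mem; apply/funext => x.
  by rewrite /kcomb big_nil.
have := hf_memP p.1 (proj1 Hk p.2) IH; congr hf_mem; apply/funext => x.
by rewrite /kcomb big_cons.
Qed.

Lemma hf_dot_kcomb s f : hf_mem H f -> hf_dot H (kcomb k s) f = kpair s f.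
Proof.
move=> Hf; elim: s => [|p s IH].
  rewrite /kpair big_nil -[RHS](hf_dot0 Hf); congr hf_dot.
  by apply/funext => x; rewrite /kcomb big_nil.
rewrite /kpair big_cons -/(kpair s f) -IH (proj2 Hk f p.2 Hf).
rewrite (hf_dotC Hf (proj1 Hk _)) -hf_dotP//; last exact: kcomb_mem.
  by congr hf_dot; apply/funext => x; rewrite /kcomb big_cons.
exact: (proj1 Hk).
Qed.

Lemma hf_dot_kcombB s s' :
  hf_dot H (fun x => kcomb k s x - kcomb k s' x)
           (fun x => kcomb k s x - kcomb k s' x) =
  kpair s (kcomb k s) - 2 * kpair s (kcomb k s') + kpair s' (kcomb k s').
Proof.
by rewrite hf_dotBB ?hf_dot_kcomb//; exact: kcomb_mem.
Qed.

End rkhs.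

(** * Membership in a reproducing kernel Hilbert space *)

(** The discriminant would give the factor [c]; the weaker [c + 1] allows [t = g / (c + 1)] also
    when [c = 0], and only the finiteness of the factor matters later. *)
Lemma quadratic_ge0_bound (R : realType) (r g c : R) : 0 <= c ->
  (forall t, 0 <= r - 2 * t * g + t ^+ 2 * c) -> g ^+ 2 <= (c + 1) * r.
Proof.
move=> c0 Q; have := Q (g / (c + 1)); set t := g / (c + 1).
have c1 : c + 1 != 0 by apply: lt0r_neq0; rewrite ltr_wpDl.
have -> : g = t * (c + 1) by rewrite /t divfK.
have : 0 <= t ^+ 2 by rewrite sqr_ge0.
by nra.
Qed.

Section rkhs_membership.
Variables (R : realType) (T : Type) (k : T -> T -> R) (H : hilbertFun R T).
Hypothesis Hk : is_rkhs k H.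
Implicit Types (s : seq (R * T)) (f g : T -> R).

Lemma rkhs_psd : psd k.
Proof.
move=> s; rewrite -(hf_dot_kcomb Hk); last exact: kcomb_mem.
by rewrite hf_dot_ge0//; exact: kcomb_mem.
Qed.

Lemma rkhs_diag_ge0 x : 0 <= k x x.
Proof.
have := rkhs_psd [:: (1, x)].
by rewrite kpair1 kcomb1 !mul1r.
Qed.

(** Point evaluations are continuous: the quadratic in [t] is the squared norm of [f] minus [t]
    times the section at [x]. *)
Lemma rkhs_eval_le f x : hf_mem H f ->
  f x ^+ 2 <= (k x x + 1) * hf_dot H f f.
Proof.
move=> Hf; apply: quadratic_ge0_bound => [|t]; first exact: rkhs_diag_ge0.
have := hf_dot_ge0 (hf_memB Hf (kcomb_mem Hk [:: (t, x)])).
rewrite hf_dotBB//; last exact: kcomb_mem.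
rewrite (hf_dotC Hf (kcomb_mem Hk _)) !(hf_dot_kcomb Hk)//; last exact: kcomb_mem.
rewrite !kpair1 kcomb1; congr (_ <= _); ring.
Qed.

(* Riesz representation: [f] is the limit of a sequence minimizing
   [|g|^2 - 2 L g] over the span of the kernel sections, where [L] is the
   functional [sum_i a_i k(x_i) |-> sum_i a_i f(x_i)]. *)
Lemma rkhs_mem_of_bound f (M : R) : 0 <= M ->
  (forall s, kpair s f ^+ 2 <= M * kpair s (kcomb k s)) ->
  hf_mem H f /\ hf_dot H f f <= M.
Proof.
move=> M0 fM; pose J s := kpair s (kcomb k s) - 2 * kpair s f.
(* Otherwise [(q + M) ^+ 2 < 4 * l ^+ 2 <= 4 * M * q], against [(q - M) ^+ 2 >= 0]. *)
have JM s : - M <= J s.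
  have := fM s; have := rkhs_psd s; rewrite /J.
  move: (kpair s _) (kpair s f) => q l q0 lM; rewrite leNgt; apply/negP => ql.
  have : (q + M) ^+ 2 < (2 * l) ^+ 2 by rewrite ltrXn2r//; lra.
  by have := sqr_ge0 (q - M); lra.
have infJ : has_inf (range J).
  split; first by exists (J [::]), [::].
  by exists (- M) => _ [s _ <-].
pose m := inf (range J).
have mJ s : m <= J s by apply: ge_inf; [exact: infJ.2|exists s].
have /choice[u uJ] n : exists s, J s < m + n.+1%:R^-1.
  have n0 : 0 < n.+1%:R^-1 :> R by rewrite invr_gt0 ltr0n.
  by have [_ [s _ <-] Js] := inf_adherent n0 infJ; exists s.
(* Parallelogram law: the midpoint of [u i] and [u j] has [J] at least [m], so two near-minimizers
   are close. *)
have u_dist i j : hf_dot H (fun x => kcomb k (u i) x - kcomb k (u j) x)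
      (fun x => kcomb k (u i) x - kcomb k (u j) x) <=
      2 * i.+1%:R^-1 + 2 * j.+1%:R^-1.
  rewrite (hf_dot_kcombB Hk); have := mJ (kscale 2^-1 (u i ++ u j)).
  rewrite /J kpair_kcomb_scale kpair_scale kpair_kcomb_cat kpair_cat.
  rewrite (kpair_kcombC (rkhs_sym Hk) (u j) (u i)).
  have := uJ i; have := uJ j; rewrite /J.
  set a := kpair (u i) (kcomb k (u i)); set b := kpair (u i) (kcomb k (u j)).
  move: a b (kpair _ _) (kpair _ f) (kpair _ f) (i.+1%:R^-1) (j.+1%:R^-1).
  move=> a b c la lb ei ej.
  lra.
have [||h Hh uh] := hf_complete (h0 := H) (u := fun n => kcomb k (u n)).
  by move=> n; exact: kcomb_mem.
  move=> e e0; have e4 : 0 < e ^+ 2 / 4 by rewrite divr_gt0 ?exprn_gt0.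
  have [N] := ltr_add_invr e4; rewrite add0r => Ne; exists N => i j Ni Nj.
  rewrite -[ltRHS]ger0_norm ?ltW// -sqrtr_sqr ltr_sqrt ?exprn_gt0//.
  apply: le_lt_trans (u_dist i j) _.
  have : i.+1%:R^-1 <= N.+1%:R^-1 :> R by rewrite lef_pV2 ?posrE ?ltr0n ?ler_nat.
  have : j.+1%:R^-1 <= N.+1%:R^-1 :> R by rewrite lef_pV2 ?posrE ?ltr0n ?ler_nat.
  move: Ne; move: (i.+1%:R^-1) (j.+1%:R^-1) (N.+1%:R^-1) (e ^+ 2) => a b c e2.
  by lra.
pose r n := hf_dot H (fun x => kcomb k (u n) x - h x)
              (fun x => kcomb k (u n) x - h x).
have r0 n : 0 <= r n by apply/hf_dot_ge0/hf_memB => //; exact: kcomb_mem.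
have r_small e : 0 < e -> exists2 n, n.+1%:R^-1 < e & r n < e.
  (* The cap at 1 ensures [r n <= Num.sqrt (r n)]. *)
  move=> e0; pose e' := Num.min e 1.
  have e'0 : 0 < e' by rewrite lt_min e0 ltr01.
  have /cvgr0Pnorm_lt/(_ _ e'0) uh' := uh.
  have inv_lt := near_infty_natSinv_lt (PosNum e0).
  have [n [nuh ne]] := filter_ex (filterI uh' inv_lt).
  exists n => //; move: nuh; rewrite /= ger0_norm ?sqrtr_ge0// -/(r n) => nuh.
  have : Num.sqrt (r n) < e /\ Num.sqrt (r n) < 1.
    by move: nuh; rewrite /e' lt_min => /andP[].
  by have := sqr_sqrtr (r0 n); have := sqrtr_ge0 (r n); nra.
have fh : f = h.
  apply/funext => x; apply/eqP; rewrite -subr_eq0 -sqrf_eq0 eq_le sqr_ge0 andbT.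
  apply/ler_addgt0Pl => e e0; rewrite addr0.
  have k1 : 0 < k x x + 1 by rewrite ltr_wpDl ?rkhs_diag_ge0.
  have [n ne rne] := r_small (e / (4 * (k x x + 1))) ltac:(by rewrite divr_gt0// mulr_gt0).
  (* First-order condition at a near-minimum: moving [u n] by [t] times the section at [x] cannot
     lower [J] by more than [n.+1%:R^-1], so [u n] almost agrees with [f] at [x]. *)
  have uf : (f x - kcomb k (u n) x) ^+ 2 <= (k x x + 1) * n.+1%:R^-1.
    apply: quadratic_ge0_bound => [|t]; first exact: rkhs_diag_ge0.
    have := mJ (u n ++ [:: (t, x)]).
    rewrite /J kpair_kcomb_cat kpair_cat (kpair_kcombC (rkhs_sym Hk) (u n) [:: _]).
    rewrite !kpair1 kcomb1.
    have := uJ n; rewrite /J; move: (n.+1%:R^-1) (k x x) => a b.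
    by lra.
  have uh1 := rkhs_eval_le x (hf_memB (kcomb_mem Hk (u n)) Hh).
  rewrite -/(r n) in uh1.
  have eE : (k x x + 1) * (e / (4 * (k x x + 1))) = e / 4.
    by field; apply: lt0r_neq0.
  have l1 : (k x x + 1) * n.+1%:R^-1 < e / 4 by rewrite -eE ltr_pM2l.
  have l2 : (k x x + 1) * r n < e / 4 by rewrite -eE ltr_pM2l.
  have : (f x - h x) ^+ 2 <=
      2 * (f x - kcomb k (u n) x) ^+ 2 + 2 * (kcomb k (u n) x - h x) ^+ 2.
    have : 0 <= ((f x - kcomb k (u n) x) - (kcomb k (u n) x - h x)) ^+ 2.
      exact: sqr_ge0.
    by move: (f x) (kcomb k (u n) x) (h x) => a b c; lra.
  move: uf uh1 l1 l2; move: (n.+1%:R^-1) ((f x - h x) ^+ 2) => a b.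
  move: ((f x - _) ^+ 2) ((_ - h x) ^+ 2) ((k x x + 1) * a) (_ * r n).
  by clear; move=> *; lra.
split; first by rewrite fh.
apply/ler_addgt0Pl => e e0; have [n _ rne] := r_small e e0.
(* Since [h = f], the squared norm of [f] is [r n - J (u n)], and [J >= - M]. *)
have : r n = J (u n) + hf_dot H f f.
  rewrite /r hf_dotBB//; last exact: kcomb_mem.
  rewrite !(hf_dot_kcomb Hk)//; last exact: kcomb_mem.
  by rewrite /J fh; lra.
by have := JM (u n); lra.
Qed.

End rkhs_membership.

(** * Positive semidefiniteness of the Gaussian kernel *)

Section psd_kernels.
Variables (R : realType) (T : Type).
Implicit Types (k : T -> T -> R) (g : T -> R) (s : seq (R * T)).

Lemma kpair_kcombE k s :
  kpair s (kcomb k s) = \sum_(p <- s) \sum_(q <- s) p.1 * (q.1 * k q.2 p.2).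
Proof. by apply: eq_bigr => p _; rewrite mulr_sumr. Qed.

Lemma psd_cst1 : psd (fun _ _ : T => 1 : R).
Proof.
move=> s; rewrite kpair_kcombE; under eq_bigr => p _.
  under eq_bigr do rewrite mulr1.
  rewrite -mulr_sumr; over.
by rewrite -mulr_suml -expr2 sqr_ge0.
Qed.

Lemma psd_rank1 k g : psd k -> psd (fun x y => g x * g y * k x y).
Proof.
move=> kP s; have := kP [seq (p.1 * g p.2, p.2) | p <- s].
rewrite !kpair_kcombE big_map; congr (_ <= _); apply: eq_bigr => p _.
by rewrite big_map; apply: eq_bigr => q _ /=; ring.
Qed.

Lemma psd_sum (I : Type) (r : seq I) (k : I -> T -> T -> R) :
  (forall i, psd (k i)) -> psd (fun x y => \sum_(i <- r) k i x y).
Proof.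
move=> kP s; rewrite kpair_kcombE.
under eq_bigr do under eq_bigr do rewrite !mulr_sumr.
under eq_bigr do rewrite exchange_big/=.
rewrite exchange_big sumr_ge0// => i _.
by rewrite -kpair_kcombE kP.
Qed.

Lemma psd_lim (k_ : nat -> T -> T -> R) k : (forall n, psd (k_ n)) ->
  (forall x y, (fun n => k_ n x y) @ \oo --> k x y) -> psd k.
Proof.
move=> kP k_k s.
have lim_s : (fun n => kpair s (kcomb (k_ n) s)) @ \oo --> kpair s (kcomb k s).
  rewrite kpair_kcombE; under eq_fun do rewrite kpair_kcombE.
  apply: cvg_big => [|p _]; first exact: add_continuous.
  apply: cvg_big => [|q _]; first exact: add_continuous.
  by do 2 (apply: cvgM; first exact: cvg_cst); exact: k_k.
rewrite -(cvg_lim _ lim_s)//; apply: limr_ge; first by apply: cvgP lim_s.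
by apply: nearW => n; exact: kP.
Qed.

(** Partial sums of the exponential series combine the powers with coefficients [1 / n!], and
    positive semidefiniteness passes to pointwise limits. *)
Lemma psd_expR k : (forall n, psd (fun x y => k x y ^+ n)) ->
  psd (fun x y => expR (k x y)).
Proof.
move=> kP; apply: (@psd_lim (fun n x y => series (exp_coeff (k x y)) n)) => [n|x y].
  apply: psd_sum => i s; rewrite kpair_kcombE.
  have -> : \sum_(p <- s) \sum_(q <- s)
      p.1 * (q.1 * exp_coeff (k q.2 p.2) i) =
      (i`!%:R)^-1 * kpair s (kcomb (fun x y => k x y ^+ i) s).
    rewrite kpair_kcombE mulr_sumr; apply: eq_bigr => p _.
    by rewrite mulr_sumr; apply: eq_bigr => q _; rewrite /exp_coeff/=; ring.
  by rewrite mulr_ge0// ?invr_ge0//; exact: kP.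
exact: is_cvg_series_exp_coeff.
Qed.

End psd_kernels.

(** The kernel on the whole space, since the smoothing uses centres outside the unit ball. *)
Definition rV_gauss (R : realType) (d : nat) (sigma : R) (x y : 'rV[R]_d) : R :=
  expR (- (sigma ^+ 2 * enorm (x - y) ^+ 2)).

Section gaussian.
Variables (R : realType) (d : nat).
Implicit Types (x y : 'rV[R]_d) (sigma : R).

Lemma enorm_ge0 x : 0 <= enorm x.
Proof. exact: sqrtr_ge0. Qed.

Lemma enorm_sqr x : enorm x ^+ 2 = \sum_(i < d) x ord0 i ^+ 2.
Proof. by rewrite sqr_sqrtr// sumr_ge0// => i _; rewrite sqr_ge0. Qed.

Lemma enormBC x y : enorm (x - y) = enorm (y - x).
Proof.
congr Num.sqrt; apply: eq_bigr => i _.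
by rewrite !mxE -sqrrN opprB.
Qed.

Lemma enorm_sqrB x y : enorm (x - y) ^+ 2 =
  enorm x ^+ 2 + enorm y ^+ 2 - 2 * \sum_(i < d) x ord0 i * y ord0 i.
Proof.
rewrite !enorm_sqr mulr_sumr -big_split/= -sumrB; apply: eq_bigr => i _.
by rewrite !mxE; ring.
Qed.

Lemma rV_gaussC sigma x y : rV_gauss sigma x y = rV_gauss sigma y x.
Proof. by rewrite /rV_gauss enormBC. Qed.

Lemma rV_gauss_ge0 sigma x y : 0 <= rV_gauss sigma x y.
Proof. exact: expR_ge0. Qed.

(** This factorization reduces sums over a [d]-dimensional grid to one-dimensional ones. *)
Lemma expR_enorm_prod (c : R) x y : expR (- (c * enorm (x - y) ^+ 2)) =
  \prod_(i < d) expR (- (c * (x ord0 i - y ord0 i) ^+ 2)).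
Proof.
rewrite -expR_sum enorm_sqr mulr_sumr sumrN; congr (expR (- _)).
by apply: eq_bigr => i _; rewrite !mxE.
Qed.

(** Induction on [n]: each further factor is a sum over [i] of [Num.sqrt c * x ord0 i] times the
    same for [y], so rank-one multiplications suffice in place of the Schur product theorem. *)
Lemma psd_dot_exp (c : R) n : 0 <= c ->
  psd (fun x y => (c * \sum_(i < d) x ord0 i * y ord0 i) ^+ n).
Proof.
move=> c0; elim: n => [|n IH]; first exact: psd_cst1.
have := @psd_sum _ _ 'I_d (index_enum _) _ (fun i =>
  psd_rank1 (fun x : 'rV[R]_d => Num.sqrt c * x ord0 i) IH).
congr psd; apply/funext => x; apply/funext => y.
rewrite exprS mulr_sumr mulr_suml; apply: eq_bigr => i _.
by rewrite -{4}(sqr_sqrtr c0); ring.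
Qed.

(* [-|x - y|^2 = -|x|^2 - |y|^2 + 2 <x, y>], and the powers of [<x, y>] are
   positive semidefinite. *)
Lemma psd_rV_gauss sigma : psd (rV_gauss sigma : 'rV[R]_d -> _ -> R).
Proof.
have c0 : 0 <= 2 * sigma ^+ 2 by rewrite mulr_ge0// sqr_ge0.
have := psd_rank1 (fun x => expR (- (sigma ^+ 2 * enorm x ^+ 2)))
  (psd_expR (fun n => psd_dot_exp n c0)).
congr psd; apply/funext => x; apply/funext => y.
by rewrite -!expRD /rV_gauss enorm_sqrB; congr expR; ring.
Qed.

End gaussian.

(** * Sums of unimodal functions over the integers *)

Section unimodal_sums.
Variables (R : realType) (G : R -> R).
Hypothesis G_ge0 : forall t, 0 <= G t.
Hypothesis G_unimodal : forall a b, `|a| <= `|b| -> G b <= G a.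

(** If the last index is at most [v], then [v - m] is at least its distance to [m] for every [m],
    and reversing the order compares the sums term by term; otherwise the last index does not
    contribute. *)
Lemma unimodal_sum_left_le M v :
  \sum_(m < M | m%:R <= v) G (v - m%:R) <= \sum_(j < M) G j%:R.
Proof.
elim: M => [|M IH]; first by rewrite !big_ord0.
have [Mv|vM] := leP (M%:R : R) v.
  rewrite big_mkcond [leRHS](reindex_inj rev_ord_inj)/=; apply: ler_sum => m _.
  have mM : (m <= M)%N by rewrite -ltnS.
  have mMR : m%:R <= M%:R :> R by rewrite ler_nat.
  case: ifPn => // mv; apply: G_unimodal; rewrite subSS natrB//.
  by rewrite !ger0_norm//; lra.
rewrite big_mkcond !big_ord_recr/= (lt_geF vM) addr0 -big_mkcond/=.
by rewrite (le_trans IH)// lerDl.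
Qed.

Lemma unimodal_sum_right_le M v :
  \sum_(m < M | v <= m%:R) G (v - m%:R) <= \sum_(j < M) G j%:R.
Proof.
case: M => [|M]; first by rewrite !big_ord0.
apply: le_trans (unimodal_sum_left_le M.+1 (M%:R - v)).
rewrite [leLHS](reindex_inj rev_ord_inj)/= le_eqVlt; apply/orP; left.
apply/eqP/eq_big => m; have mM : (m <= M)%N by rewrite -ltnS.
  by rewrite subSS natrB//; apply/idP/idP; lra.
rewrite subSS natrB// => _.
have -> : v - (M%:R - m%:R) = - (M%:R - v - m%:R) by ring.
by apply/le_anti/andP; split; apply: G_unimodal; rewrite normrN.
Qed.

Lemma unimodal_sum_le M v :
  \sum_(m < M) G (v - m%:R) <= 2 * \sum_(j < M) G j%:R.
Proof.
rewrite (bigID (fun m : 'I_M => m%:R <= v))/= mulrDl mul1r.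
rewrite lerD ?unimodal_sum_left_le//.
apply: le_trans (unimodal_sum_right_le M v).
rewrite big_mkcond [leRHS]big_mkcond; apply: ler_sum => m _.
by rewrite -ltNge; case: ifPn => [/ltW ->//|_]; case: ifP.
Qed.

Lemma unimodal_sum_ge M A v : A%:R <= v -> v + A%:R + 1 <= M%:R ->
  2 * \sum_(j < A) G j.+1%:R <= \sum_(m < M) G (v - m%:R).
Proof.
move=> Av vM; have v0 : 0 <= v by apply: le_trans Av.
have /andP[pv vp] := truncn_itv v0; set p := Num.truncn v in pv vp.
(* The [B] integers nearest to [v] on either side lie within [1, ..., B] of it; [B <= p.+1] keeps
   the natural subtraction from truncating. *)
have window B : (B <= p.+1)%N -> 2 * \sum_(j < B) G j.+1%:R <=
    \sum_(p.+1 - B <= m < p.+1 + B) G (v - m%:R).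
  elim: B => [|B IH] Bp; first by rewrite big_ord0 mulr0 sumr_ge0.
  rewrite subSS addnS big_nat_recr/=; last by rewrite leq_subLR; lia.
  rewrite big_ltn; last by lia.
  rewrite -subSn// big_ord_recr/= mulrDr; have := IH (ltnW Bp).
  have : G B.+1%:R <= G (v - (p - B)%:R).
    apply: G_unimodal; rewrite natrB// !ger0_norm ?subr_ge0//.
      by rewrite -[B.+1]addn1 natrD; rewrite -[p.+1]addn1 natrD in vp; lra.
    by have : 0 <= B%:R :> R by []; lra.
  have : G B.+1%:R <= G (v - (p.+1 + B)%:R).
    apply: G_unimodal; rewrite ler0_norm ?ger0_norm//.
      by rewrite natrD -[B.+1]addn1 natrD -[p.+1]addn1 natrD; lra.
    rewrite natrD; have : 0 <= B%:R :> R by [].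
    by move: vp; set q := p.+1%:R; lra.
  by lra.
have pA : (A <= p)%N by rewrite truncn_ge_nat.
have pM : (p.+1 + A <= M)%N.
  by rewrite -(ler_nat R) natrD -[p.+1]addn1 natrD; lra.
apply: le_trans (window A (leqW pA)) _.
rewrite -[leRHS](big_mkord xpredT (fun m => G (v - m%:R))).
rewrite (@big_cat_nat _ _ _ (p.+1 - A)%N 0 M)//=; last by lia.
rewrite (@big_cat_nat _ _ _ (p.+1 + A)%N (p.+1 - A)%N M)//=; last by lia.
by rewrite addrCA lerDl addr_ge0// sumr_ge0.
Qed.

End unimodal_sums.

Lemma sum_expR_le (R : realType) (n A : nat) : (0 < n)%N ->
  \sum_(j < A) expR (- (j.+1%:R / n%:R)) <= n%:R :> R.
Proof.
move=> n0; set q := expR (- n%:R^-1) : R.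
have nR : 0 < n%:R :> R by rewrite ltr0n.
have q0 : 0 < q by exact: expR_gt0.
have qn : q * (n%:R + 1) <= n%:R.
  have := expR_ge1Dx (n%:R^-1 : R); have := expRxMexpNx_1 (n%:R^-1 : R).
  rewrite -/q; set e := expR _ => eq1 en.
  have : n%:R * (1 + n%:R^-1) <= n%:R * e by rewrite ler_pM2l.
  rewrite mulrDr mulfV ?lt0r_neq0// mulr1 => ne.
  have : q * (n%:R + 1) <= q * (n%:R * e) by rewrite ler_pM2l.
  by rewrite mulrCA [q * e]mulrC eq1 mulr1.
(* Geometric series of ratio [q = e^(-1/n)]; the induction step is [q * (n + 1) <= n], which comes
   from [1 + 1/n <= e^(1/n)]. *)
have H B : \sum_(j < B) expR (- (j.+1%:R / n%:R)) <= n%:R * (1 - q ^+ B).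
  elim: B => [|B IH]; first by rewrite big_ord0 expr0 subrr mulr0.
  rewrite big_ord_recr/=; have -> : expR (- (B.+1%:R / n%:R)) = q * q ^+ B.
    by rewrite -exprS -expRM_natl mulrN.
  rewrite exprS; have : 0 < q ^+ B by rewrite exprn_gt0.
  by move: IH; nra.
apply: le_trans (H A) _; have : 0 < q ^+ A by rewrite exprn_gt0.
by nra.
Qed.

Lemma count_le (R : realType) (M : nat) (r : R) : 0 <= r ->
  \sum_(j < M) (`|j%:R : R| <= r)%R%:R <= r + 1.
Proof.
(* The second bound carries the induction: while [M <= r] the count is at most [M + 1 <= r + 1]. *)
move=> r0; have : \sum_(j < M) (`|j%:R : R| <= r)%R%:R <= r + 1 /\
    \sum_(j < M) (`|j%:R : R| <= r)%R%:R <= M%:R :> R; last by case.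
elim: M => [|M [IH1 IH2]]; first by rewrite big_ord0; split => //; lra.
rewrite big_ord_recr/= ger0_norm//; case: (leP (M%:R : R) r) => Mr /=.
  by rewrite -[M.+1]addn1 natrD; lra.
by rewrite addr0 -[M.+1]addn1 natrD; lra.
Qed.

(** * Riemann sums of the one-dimensional Gaussian *)

Section gaussian_quadrature.
Variables (R : realType) (n : nat).
Hypothesis n_gt0 : (0 < n)%N.

Definition grid_point (N m : nat) : R := (m%:R - N%:R) / n%:R.

Definition gauss_half_sum (A : nat) : R :=
  \sum_(j < A) expR (- (j.+1%:R / n%:R) ^+ 2).

(** [unimodal_sum_le] bounds every shifted lattice sum by [2 + 2 * sup], so with this weight the
    total mass never exceeds 1, wherever the Gaussian is centred. *)
Definition gauss_weight : R := (2 + 2 * sup (range gauss_half_sum))^-1.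

Let nR : 0 < n%:R :> R. Proof. by rewrite ltr0n. Qed.

Let grid_pointE N m u :
  u - grid_point N m = (n%:R * u + N%:R - m%:R) / n%:R.
Proof. by rewrite /grid_point; field; exact: lt0r_neq0. Qed.

Let gauss_unimodal (c : R) : 0 <= c -> forall a b : R, `|a| <= `|b| ->
  expR (- (c * (b / n%:R) ^+ 2)) <= expR (- (c * (a / n%:R) ^+ 2)).
Proof.
move=> c0 a b ab; rewrite ler_expR lerN2 ler_wpM2l// -[leLHS]real_normK ?num_real//.
rewrite -[leRHS]real_normK ?num_real// lerXn2r ?nnegrE// !normrM ler_wpM2r//.
Qed.

(** The inequality [x ^+ 2 / 2 >= x - 1/2] replaces the Gaussian by a geometric series. *)
Let half_gauss_sum_le A :
  \sum_(j < A) expR (- (2^-1 * (j.+1%:R / n%:R) ^+ 2)) <= expR 2^-1 * n%:R :> R.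
Proof.
apply: (@le_trans _ _ (expR 2^-1 * \sum_(j < A) expR (- (j.+1%:R / n%:R)))).
  rewrite mulr_sumr; apply: ler_sum => j _; rewrite -expRD ler_expR.
  by have := sqr_ge0 (j.+1%:R / n%:R - 1 : R); nra.
by rewrite ler_wpM2l ?expR_ge0// sum_expR_le.
Qed.

Let gauss_half_sum_le A : gauss_half_sum A <= expR 2^-1 * n%:R.
Proof.
apply: le_trans (half_gauss_sum_le A); apply: ler_sum => j _.
by rewrite ler_expR; have := sqr_ge0 (j.+1%:R / n%:R : R); nra.
Qed.

Let has_sup_half_sum : has_sup (range gauss_half_sum).
Proof.
split; first by exists (gauss_half_sum 0), 0%N.
by exists (expR 2^-1 * n%:R) => _ [A _ <-].
Qed.

Let half_sum_le_sup A : gauss_half_sum A <= sup (range gauss_half_sum).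
Proof. by apply: ub_le_sup; [exact: has_sup_half_sum.2|exists A]. Qed.

(** The first [n] terms are at least [1/e] each, so the weight is at most of order [1/n]. *)
Let sup_ge : expR (-1) * n%:R <= sup (range gauss_half_sum).
Proof.
apply: le_trans (half_sum_le_sup n).
have -> : expR (-1) * n%:R = \sum_(j < n) expR (-1) :> R.
  by rewrite sumr_const card_ord mulr_natr.
apply: ler_sum => j _; rewrite ler_expR lerN2 expr_le1 ?divr_ge0//.
by rewrite ler_pdivrMr// mul1r ler_nat.
Qed.

Let sup_ge0 : 0 <= sup (range gauss_half_sum).
Proof. by apply: le_trans sup_ge; rewrite mulr_ge0 ?expR_ge0. Qed.

Lemma gauss_weight_ge0 : 0 <= gauss_weight.
Proof. by rewrite invr_ge0; have := sup_ge0; lra. Qed.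

Lemma gauss_weight_le : gauss_weight <= expR 1 / n%:R.
Proof.
have en : 0 < expR (-1) * n%:R :> R by rewrite mulr_gt0// expR_gt0.
have -> : expR 1 / n%:R = (expR (-1) * n%:R)^-1 :> R.
  by rewrite expRN invfM invrK.
move: en sup_ge sup_ge0; rewrite /gauss_weight.
move: (sup _) (expR (-1) * _) => T x x0 xT T0.
have T2 : 0 < 2 + 2 * T by lra.
by rewrite lef_pV2 ?posrE//; lra.
Qed.

Let gauss_unimodal1 (a b : R) : `|a| <= `|b| ->
  expR (- (b / n%:R) ^+ 2) <= expR (- (a / n%:R) ^+ 2).
Proof. by move/(gauss_unimodal ler01); rewrite !mul1r. Qed.

Lemma gauss_quadrature_le1 M N u :
  gauss_weight * \sum_(m < M) expR (- (u - grid_point N m) ^+ 2) <= 1.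
Proof.
rewrite mulrC ler_pdivrMr ?mul1r; last by have := sup_ge0; lra.
under eq_bigr do rewrite grid_pointE.
apply: le_trans (unimodal_sum_le _ gauss_unimodal1 _ _) _.
  by move=> t; exact: expR_ge0.
case: M => [|M]; first by rewrite big_ord0; have := sup_ge0; lra.
rewrite big_ord_recl/= mul0r expr0n/= oppr0 expR0.
have := half_sum_le_sup M; rewrite /gauss_half_sum.
by under eq_bigr do rewrite /bump/= add1n; lra.
Qed.

(** Twice a half sum within 1 of its supremum falls short of [2 + 2 * sup] by at most 4, and the
    weight is at most [e / n]. The grid is long enough to contain [A] points on each side of [n * u]
    whenever [u] is at most [U] in absolute value. *)
Lemma gauss_quadrature_ge (U : R) : 0 <= U ->
  exists N, forall u, `|u| <= U -> 1 - 4 * (expR 1 / n%:R) <=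
    gauss_weight * \sum_(m < N.*2.+1) expR (- (u - grid_point N m) ^+ 2).
Proof.
move=> U0; have [_ [A _ <-] TA] := sup_adherent ltr01 has_sup_half_sum.
have nU0 : 0 <= n%:R * U by rewrite mulr_ge0.
exists (A + (Num.truncn (n%:R * U)).+1)%N => u uU; set N := (A + _)%N.
have NA : A%:R + n%:R * U <= N%:R.
  by rewrite natrD lerD2l; have /andP[_ /ltW] := truncn_itv nU0.
under eq_bigr do rewrite grid_pointE.
have uU' : `|n%:R * u| <= n%:R * U by rewrite normrM ger0_norm// ler_pM2l.
move: uU'; rewrite ler_norml => /andP[u1 u2].
have := unimodal_sum_ge (G := fun t : R => expR (- (t / n%:R) ^+ 2))
  (fun t => expR_ge0 _) gauss_unimodal1
  (M := N.*2.+1) (A := A) (v := n%:R * u + N%:R).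
move=> /(_ ltac:(lra)) /(_ _)/wrap[].
  by rewrite -[N.*2.+1]addn1 natrD -addnn natrD; lra.
move=> HS; apply: (@le_trans _ _ (gauss_weight * (2 * gauss_half_sum A))); last first.
  by rewrite ler_wpM2l ?gauss_weight_ge0.
have := gauss_weight_ge0; have := gauss_weight_le; rewrite {1 2}/gauss_weight.
have T0 := sup_ge0; move: TA T0; set T := sup _ => TA T0.
set e := expR 1 / _; set g := gauss_half_sum _ in TA *.
have wT : gauss_weight * (2 + 2 * T) = 1.
  by rewrite /gauss_weight -/T mulVf//; apply: lt0r_neq0; lra.
rewrite -/T in wT *; rewrite -/gauss_weight; set w := gauss_weight in wT *.
by nra.
Qed.

(** The order [n] of the lattice sum cancels the weight, so the bound depends on neither the grid
    nor [n]. The exponent is halved because the other half yields the decay in [tau]. *)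
Lemma gauss_quadrature_half_le M N u :
  gauss_weight * \sum_(m < M) expR (- (2^-1 * (u - grid_point N m) ^+ 2)) <=
  expR 1 * (2 + 2 * expR 2^-1).
Proof.
under eq_bigr do rewrite grid_pointE.
have h0 : 0 <= 2^-1 :> R by [].
have n1 : 1 <= n%:R :> R by rewrite ler1n.
apply: (@le_trans _ _ (gauss_weight * ((2 + 2 * expR 2^-1) * n%:R))).
  rewrite ler_wpM2l ?gauss_weight_ge0//.
  apply: le_trans (unimodal_sum_le _ (gauss_unimodal h0) _ _) _.
    by move=> t; exact: expR_ge0.
  have e0 : 0 < expR 2^-1 :> R := expR_gt0 _.
  case: M => [|M]; first by rewrite big_ord0; nra.
  rewrite big_ord_recl/= mul0r expr0n/= mulr0 oppr0 expR0.
  have := half_gauss_sum_le M.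
  by under eq_bigr do rewrite /bump/= add1n; nra.
apply: (@le_trans _ _ (expR 1 / n%:R * ((2 + 2 * expR 2^-1) * n%:R))).
  by rewrite ler_wpM2r ?gauss_weight_le// mulr_ge0// addr_ge0// mulr_ge0// expR_ge0.
by rewrite mulrCA divfK ?lt0r_neq0// mulrC.
Qed.

(** The indicator of an interval centred at 0 is unimodal, so the lattice sum bound counts grid
    points. *)
Lemma grid_count_le M N (r : R) : 0 <= r ->
  \sum_(m < M) (`|grid_point N m| <= r)%R%:R <= 2 * (n%:R * r + 1).
Proof.
move=> r0; have nr0 : 0 <= n%:R * r by rewrite mulr_ge0.
apply: le_trans (_ : \sum_(m < M) (`|N%:R - m%:R| <= n%:R * r)%R%:R <= _).
  apply: ler_sum => m _; rewrite /grid_point distrC normrM normfV.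
  by rewrite (ger0_norm (ltW nR)) ler_pdivrMr// mulrC.
apply: le_trans (@unimodal_sum_le R (fun t : R => (`|t| <= n%:R * r)%R%:R) _ _ _ _) _.
- by [].
- move=> a b ab; rewrite ler_nat; case: (leP `|b|) => // br.
  by rewrite (le_trans ab br).
- by rewrite ler_wpM2l// count_le.
Qed.

End gaussian_quadrature.

(** * Gaussian smoothing of a labelling *)

(** Bernoulli's inequality; it passes from the mass defect in one coordinate to that in [d]
    coordinates. *)
Lemma expr1B_ge (R : realType) (a : R) d : 0 <= a <= 1 ->
  1 - d%:R * a <= (1 - a) ^+ d.
Proof.
move=> /andP[a0 a1]; elim: d => [|d IH]; first by rewrite mul0r subr0 expr0.
have : (1 - a) * (1 - d%:R * a) <= (1 - a) ^+ d.+1.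
  by rewrite exprS ler_wpM2l// subr_ge0.
apply: le_trans; rewrite -[d.+1]addn1 natrD.
have : 0 <= d%:R * a ^+ 2 by rewrite mulr_ge0 ?sqr_ge0.
by move: d%:R => x; nra.
Qed.

Lemma prodr_le_expr (R : realType) d (F : 'I_d -> R) (c : R) :
  (forall i, 0 <= F i <= c) -> \prod_(i < d) F i <= c ^+ d.
Proof.
move=> Fc; apply: (@le_trans _ _ (\prod_(i < d) c)).
  by apply: ler_prod => i _; exact: Fc.
by rewrite prodr_const card_ord.
Qed.

Lemma sum_ffun_prod (R : realType) d M (w : R) (F : 'I_d -> 'I_M -> R) :
  \sum_(p : {ffun 'I_d -> 'I_M}) w ^+ d * \prod_(i < d) F i (p i) =
  \prod_(i < d) (w * \sum_(m < M) F i m).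
Proof.
under [RHS]eq_bigr do rewrite mulr_sumr.
rewrite bigA_distr_bigA; apply: eq_bigr => p _.
by rewrite big_split/= prodr_const card_ord.
Qed.

Lemma coord_le_enorm (R : realType) d (x : 'rV[R]_d) i :
  `|x ord0 i| <= enorm x.
Proof.
rewrite -sqrtr_sqr ler_wsqrtr// (bigD1 i)//= lerDl sumr_ge0// => j _.
exact: sqr_ge0.
Qed.

(** The [d]-th power of the bound in [gauss_quadrature_half_le]: it bounds the mass of the Gaussian
    with half the exponent. *)
Definition gauss_tail_cst (R : realType) (d : nat) : R :=
  (expR 1 * (2 + 2 * expR 2^-1)) ^+ d.

(* The combination is [w^d sum_y s(y) rV_gauss(y, .)] over a fine grid: a
   Riemann sum for the convolution of [s] with a normalized Gaussian. *)
Lemma gauss_approx (R : realType) (d : nat) (sigma eps : R)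
    (s : 'rV[R]_d -> R) : 0 < sigma -> 0 < eps -> (forall y, `|s y| <= 1) ->
    (forall y, s y != 0 -> forall i, `|y ord0 i| <= 3) ->
  exists l : seq (R * 'rV[R]_d),
  [/\ kpair l (kcomb (rV_gauss sigma) l) <= (8 * expR 1 * sigma) ^+ d,
      forall x, `|kcomb (rV_gauss sigma) l x| <= 1 &
      forall x b tau, `|b| <= 1 -> enorm x <= 1 -> 0 <= tau ->
        (forall y, enorm (y - x) < tau -> s y = b) ->
        `|b - kcomb (rV_gauss sigma) l x| <=
        eps + 2 * gauss_tail_cst R d * expR (- (sigma ^+ 2 * tau ^+ 2 / 2))].
Proof.
move=> sigma0 eps0 s1 s3; set e : R := expR 1.
have e0 : 0 < e by exact: expR_gt0.
(* The conditions on the mesh absorb the [+ 1] of the grid count, make Bernoulli's inequality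
   applicable, and push the mass defect below [eps]. *)
have [n [n0 sn en den]] : exists n, [/\ (0 < n)%N, 1 <= sigma * n%:R,
    4 * (e / n%:R) <= 1 & d%:R * (4 * (e / n%:R)) <= eps].
  pose m (x : R) := (Num.truncn x).+1.
  have mP x : 0 <= x -> x <= (m x)%:R.
    by move=> x0; rewrite ltW//; have /andP[] := truncn_itv x0.
  have a0 : 0 <= sigma^-1 by rewrite invr_ge0 ltW.
  have b0 : 0 <= 4 * e by rewrite mulr_ge0// ltW.
  have c0 : 0 <= d%:R * (4 * e) / eps by rewrite divr_ge0 ?mulr_ge0// ltW.
  pose n := (m sigma^-1 + m (4 * e)%R + m (d%:R * (4 * e) / eps)%R)%N.
  have n0 : (0 < n)%N by rewrite /n /m addn_gt0 addnS.
  have nR : 0 < n%:R :> R by rewrite ltr0n.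
  have nle x k : (m x <= k)%N -> 0 <= x -> x <= k%:R.
    by move=> mk x0; apply: le_trans (mP x x0) _; rewrite ler_nat.
  exists n; split => //.
  - rewrite mulrC -ler_pdivrMr// mul1r; apply: nle => //.
    by rewrite /n -addnA leq_addr.
  - rewrite mulrA ler_pdivrMr// mul1r; apply: nle => //.
    by rewrite /n addnAC leq_addl.
  - rewrite (_ : _ * _ = d%:R * (4 * e) / n%:R); last by ring.
    rewrite ler_pdivrMr// [leRHS]mulrC -ler_pdivrMr//; apply: nle => //.
    by rewrite /n leq_addl.
have nR : 0 < n%:R :> R by rewrite ltr0n.
(* The quadrature is used at [sigma * x ord0 i], which is at most [sigma] in absolute value on the
   unit ball. *)
have [N HN] := gauss_quadrature_ge n0 (ltW sigma0).
set M := N.*2.+1 in HN; set w := gauss_weight R n.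
have w0 : 0 <= w := gauss_weight_ge0 _ n0.
have wd0 : 0 <= w ^+ d by rewrite exprn_ge0.
pose pt (p : {ffun 'I_d -> 'I_M}) : 'rV[R]_d :=
  \row_i (grid_point R n N (p i) / sigma).
pose l := [seq (w ^+ d * s (pt p), pt p) | p <- index_enum {ffun 'I_d -> 'I_M}].
have kcombE x : kcomb (rV_gauss sigma) l x =
    \sum_p w ^+ d * rV_gauss sigma (pt p) x * s (pt p).
  by rewrite /kcomb big_map; apply: eq_bigr => p _ /=; ring.
pose W x := \sum_p w ^+ d * rV_gauss sigma (pt p) x.
have gaussE c x : \sum_p w ^+ d * expR (- (c * sigma ^+ 2 * enorm (pt p - x) ^+ 2)) =
  \prod_(i < d) (w * \sum_(m < M)
    expR (- (c * (sigma * x ord0 i - grid_point R n N m) ^+ 2))).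
  rewrite -sum_ffun_prod; apply: eq_bigr => p _; rewrite expR_enorm_prod.
  congr (_ * _); apply: eq_bigr => i _; congr (expR (- _)).
  by rewrite mxE; field; exact: lt0r_neq0.
have WE x : W x = \prod_(i < d) (w * \sum_(m < M)
    expR (- (sigma * x ord0 i - grid_point R n N m) ^+ 2)).
  rewrite /W /rV_gauss; have := gaussE 1 x; rewrite mul1r => ->; apply: eq_bigr => i _.
  by under eq_bigr do rewrite mul1r.
have W_le1 x : W x <= 1.
  rewrite WE; apply: le_trans (prodr_le_expr _ : _ <= 1 ^+ d) _; last first.
    by rewrite expr1n.
  by move=> i; rewrite gauss_quadrature_le1// andbT mulr_ge0// sumr_ge0// => m _.
have W_ge x : enorm x <= 1 -> 1 - eps <= W x.
  move=> x1; apply: (@le_trans _ _ ((1 - 4 * (e / n%:R)) ^+ d)).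
    apply: le_trans (expr1B_ge d _); first by rewrite lerD2l lerN2.
    by rewrite en andbT mulr_ge0// divr_ge0// ltW.
  rewrite WE -[X in _ ^+ X]card_ord -prodr_const; apply: ler_prod => i _.
  rewrite subr_ge0 en/= HN// normrM gtr0_norm// -[leRHS]mulr1 ler_pM2l//.
  exact: le_trans (coord_le_enorm x i) x1.
have term_ge0 x p : 0 <= w ^+ d * rV_gauss sigma (pt p) x.
  by rewrite mulr_ge0// rV_gauss_ge0.
have comb_le1 x : `|kcomb (rV_gauss sigma) l x| <= 1.
  rewrite kcombE; apply: le_trans (ler_norm_sum _ _ _) _.
  apply: le_trans (W_le1 x); apply: ler_sum => p _.
  by rewrite normrM (ger0_norm (term_ge0 x p)) ler_piMr.
exists l; split=> [|//|x b tau b1 x1 tau0 sb].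
- rewrite /kpair big_map/=.
  pose box (m : 'I_M) : R := (`|grid_point R n N m| <= 3 * sigma)%R%:R.
  (* Labels and values of the combination are at most 1 in absolute value, so the double sum is at
     most [w ^+ d] times the number of grid points in the cube. *)
  apply: (@le_trans _ _ (\sum_(p : {ffun 'I_d -> 'I_M}) w ^+ d *
      \prod_(i < d) box (p i))).
    apply: ler_sum => p _; rewrite -mulrA ler_wpM2l//.
    apply: le_trans (ler_norm _) _; rewrite normrM.
    have [sp|sp] := eqVneq (s (pt p)) 0.
      by rewrite sp normr0 mul0r prodr_ge0.
    rewrite big1 => [|i _].
      by rewrite mulr_ile1.
    have := s3 _ sp i; rewrite mxE normrM normfV (gtr0_norm sigma0).
    by rewrite ler_pdivrMr// /box => ->.
  rewrite (sum_ffun_prod w (fun _ => box)).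
  apply: prodr_le_expr => i; apply/andP; split.
    by rewrite mulr_ge0// sumr_ge0.
  have s30 : 0 <= 3 * sigma by rewrite mulr_ge0// ltW.
  have := grid_count_le n0 M N s30; set S := \sum_(m < M) _ => SM.
  have S8 : S <= 8 * (sigma * n%:R) by move: SM sn; lra.
  apply: (@le_trans _ _ (e / n%:R * (8 * (sigma * n%:R)))).
    apply: ler_pM => //; first by rewrite sumr_ge0.
    exact: gauss_weight_le.
  by rewrite le_eqVlt; apply/orP; left; apply/eqP; field; exact: lt0r_neq0.
(* The first summand is the mass defect; the terms of the second vanish at grid points with label
   [b]. *)
- have -> : b - kcomb (rV_gauss sigma) l x = b * (1 - W x) +
      \sum_p w ^+ d * rV_gauss sigma (pt p) x * (b - s (pt p)).
    rewrite kcombE; under [X in _ = _ + X]eq_bigr do rewrite mulrBr.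
    by rewrite sumrB -mulr_suml -/(W x); ring.
  apply: le_trans (ler_normD _ _) _; apply: lerD.
    have := W_ge x x1; have := W_le1 x; rewrite normrM => h1 h2.
    rewrite (@ger0_norm _ (1 - W x)) ?subr_ge0//.
    have : `|b| * (1 - W x) <= 1 - W x by rewrite ler_piMl// subr_ge0.
    by lra.
  set E := expR _; have E0 : 0 <= E := expR_ge0 _.
  apply: le_trans (ler_norm_sum _ _ _) _.
  (* Outside the ball of radius [tau], half of the exponent gives the decay [E] and the other half
     stays in the sum over the grid. *)
  apply: (@le_trans _ _ (\sum_p 2 * E * (w ^+ d *
      expR (- (2^-1 * sigma ^+ 2 * enorm (pt p - x) ^+ 2))))).
    apply: ler_sum => p _; rewrite normrM (ger0_norm (term_ge0 x p)).
    have [ptau|ptau] := ltP (enorm (pt p - x)) tau.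
      by rewrite sb// subrr normr0 mulr0 !mulr_ge0 ?expR_ge0.
    set h := expR _; have h0 : 0 <= h := expR_ge0 _.
    have gE : rV_gauss sigma (pt p) x <= E * h.
      rewrite -expRD ler_expR.
      have : tau ^+ 2 <= enorm (pt p - x) ^+ 2.
        by rewrite lerXn2r ?nnegrE// enorm_ge0.
      have : 0 <= sigma ^+ 2 by rewrite sqr_ge0.
      by nra.
    have bs : `|b - s (pt p)| <= 2.
      apply: le_trans (ler_normB _ _) _.
      by have := s1 (pt p); move: b1; lra.
    have -> : 2 * E * (w ^+ d * h) = (w ^+ d * (E * h)) * 2 by ring.
    by apply: ler_pM => //; rewrite ler_wpM2l.
  rewrite -mulr_sumr gaussE [leRHS]mulrAC ler_wpM2l ?mulr_ge0//.
  apply: prodr_le_expr => i; rewrite gauss_quadrature_half_le// andbT.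
  by rewrite mulr_ge0// sumr_ge0// => m _; exact: expR_ge0.
Qed.

(** * Geometry and measurability in the unit ball *)

Section euclidean.
Variables (R : realType) (d : nat).
Implicit Types x y z : 'rV[R]_d.

Lemma dot_le_enorm x y :
  \sum_(i < d) x ord0 i * y ord0 i <= enorm x * enorm y.
Proof.
set p := \sum_(i < d) _.
have [p0|/[dup] /ltW p1 p0] := leP p 0; first by rewrite (le_trans p0)// mulr_ge0 ?enorm_ge0.
rewrite -(@ler_pXn2r _ 2)// ?nnegrE ?mulr_ge0 ?enorm_ge0//.
rewrite exprMn.
have Q t : 0 <= enorm x ^+ 2 - 2 * t * p + t ^+ 2 * enorm y ^+ 2.
  have := sqr_ge0 (enorm (x - t *: y)); rewrite enorm_sqrB.
  congr (_ <= _); rewrite !enorm_sqr.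
  rewrite (_ : \sum_(i < d) x ord0 i * (t *: y) ord0 i = t * p).
    rewrite (_ : \sum_(i < d) (t *: y) ord0 i ^+ 2 =
                 t ^+ 2 * \sum_(i < d) y ord0 i ^+ 2); first by ring.
    by rewrite mulr_sumr; apply: eq_bigr => i _; rewrite mxE exprMn.
  by rewrite mulr_sumr; apply: eq_bigr => i _; rewrite mxE mulrCA.
have [y0|y0] := eqVneq (enorm y ^+ 2) 0.
  (* If [y] has norm 0, this [t] makes the quadratic equal to [- enorm x ^+ 2 - 2]. *)
  have := Q ((enorm x ^+ 2 + 1) / p); rewrite y0 mulr0 addr0 -mulrA divfK.
    by have := sqr_ge0 (enorm x); lra.
  exact: lt0r_neq0.
have y1 : 0 < enorm y ^+ 2 by rewrite lt_neqAle eq_sym y0 sqr_ge0.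
have := Q (p / enorm y ^+ 2).
have -> : enorm x ^+ 2 - 2 * (p / enorm y ^+ 2) * p +
    (p / enorm y ^+ 2) ^+ 2 * enorm y ^+ 2 = enorm x ^+ 2 - p ^+ 2 / enorm y ^+ 2.
  by field; move: y0; rewrite sqrf_eq0.
by rewrite subr_ge0 ler_pdivrMr.
Qed.

Lemma enormD x y : enorm (x + y) <= enorm x + enorm y.
Proof.
rewrite -(@ler_pXn2r _ 2)// ?nnegrE ?addr_ge0 ?enorm_ge0//.
have := dot_le_enorm x y.
have -> : enorm (x + y) ^+ 2 = enorm x ^+ 2 + enorm y ^+ 2 +
    2 * \sum_(i < d) x ord0 i * y ord0 i.
  rewrite !enorm_sqr mulr_sumr -!big_split/=; apply: eq_bigr => i _.
  by rewrite !mxE; ring.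
by rewrite sqrrD; lra.
Qed.

Lemma enormN x : enorm (- x) = enorm x.
Proof. by congr Num.sqrt; apply: eq_bigr => i _; rewrite mxE sqrrN. Qed.

Lemma enormZ (t : R) x : 0 <= t -> enorm (t *: x) = t * enorm x.
Proof.
move=> t0; apply: (@pexpIrn _ 2) => //; rewrite ?nnegrE ?mulr_ge0 ?enorm_ge0//.
rewrite exprMn !enorm_sqr mulr_sumr; apply: eq_bigr => i _.
by rewrite mxE exprMn.
Qed.

Lemma enorm_continuous z : continuous (fun x : 'rV[R]_d => enorm (x - z)).
Proof.
have sum_cont : continuous (fun x : 'rV[R]_d => \sum_(i < d) (x - z) ord0 i ^+ 2).
  apply: continuous_big => [|i _ x]; first exact: add_continuous.
  have ci : {for x, continuous (fun x : 'rV[R]_d => x ord0 i - z ord0 i)}.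
    apply: (@continuousB _ _ _ (fun x : 'rV[R]_d => x ord0 i) (cst (z ord0 i))).
      exact: coord_continuous.
    exact: cst_continuous.
  rewrite (_ : (fun x0 : 'rV_d => _) =
    (fun x : 'rV[R]_d => (x ord0 i - z ord0 i) * (x ord0 i - z ord0 i))).
    by exact: (continuousM ci ci).
  by apply/funext => w; rewrite !mxE expr2.
by move=> x; exact: (continuous_comp (sum_cont x) (@sqrt_continuous R _)).
Qed.

Lemma open_enorm_ball z (r : R) : open [set x : 'rV[R]_d | enorm (x - z) < r].
Proof.
have /continuousP/(_ [set t : R | t < r]) := @enorm_continuous z.
by apply; exact: open_lt.
Qed.

Definition ball_proj x : 'rV[R]_d :=
  if enorm x <= 1 then x else (enorm x)^-1 *: x.

Lemma enorm_ball_proj x : enorm (ball_proj x) <= 1.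
Proof.
rewrite /ball_proj; case: ifPn => //; rewrite -ltNge => x1.
have x0 : 0 < enorm x := lt_trans ltr01 x1.
by rewrite enormZ ?mulVf ?lt0r_neq0// invr_ge0 ltW.
Qed.

(** With [r = enorm y > 1] and [q] the inner product of [x] with [y / r], the squared distances
    differ by [(r - 1) * (r + 1 - 2 * q)], and [q <= 1]. Hence a radially extended labelling keeps
    the label of [x] near [x] outside the unit ball too. *)
Lemma ball_proj_contract x y : enorm x <= 1 ->
  enorm (x - ball_proj y) <= enorm (x - y).
Proof.
move=> x1; rewrite /ball_proj; case: ifPn => //; rewrite -ltNge => y1.
set r := enorm y in y1 *; have r0 : 0 < r := lt_trans ltr01 y1.
rewrite -(@ler_pXn2r _ 2)// ?nnegrE ?enorm_ge0// !enorm_sqrB.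
rewrite enormZ; last by rewrite invr_ge0 ltW.
rewrite -/r mulVf ?lt0r_neq0//.
rewrite (_ : \sum_(i < d) x ord0 i * (r^-1 *: y) ord0 i =
  r^-1 * \sum_(i < d) x ord0 i * y ord0 i); last first.
  by rewrite mulr_sumr; apply: eq_bigr => i _; rewrite mxE mulrCA.
have := dot_le_enorm x y; rewrite -/r; set p := \sum_(i < d) _ => pr.
have pr1 : p <= r by rewrite (le_trans pr)// ler_piMl// ltW.
have rp : r^-1 * p <= 1 by rewrite mulrC ler_pdivrMr// mul1r.
have : r^-1 * p * (r - 1) <= r - 1 by rewrite ler_piMl// subr_ge0 ltW.
have pE : p = r^-1 * p * r by rewrite mulrAC mulVf ?mul1r// lt0r_neq0.
move: pE; set q := r^-1 * p => pq; have := sqr_ge0 (r - 1); rewrite pq.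
by lra.
Qed.

End euclidean.

Section unit_ball.
Variables (R : realType) (d : nat).
Implicit Types (x a : eball R d) (A : set (eball R d)).

Lemma measurable_fun_eball (f : eball R d -> R) :
  (forall r, exists2 B : set 'rV[R]_d, open B & forall x, f x < r <-> B (sval x)) ->
  measurable_fun setT f.
Proof.
move=> fB; apply: (measurability _ (RGenCInfty.measurableE R)).
move=> _ [_ [r ->] <-]; have [B oB fr] := fB r.
rewrite setTI (_ : _ @^-1` _ = ~` [set x | B (sval x)]).
  apply: measurableC; exists B; last by rewrite setTI.
  exact: sub_sigma_algebra.
apply/seteqP; split => x /=; rewrite in_itv/= andbT leNgt.
  by move=> /negP fxr /fr.
by move=> Bx; apply/negP => /fr.
Qed.

Lemma measurable_continuous_eball (g : 'rV[R]_d -> R) : continuous g ->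
  measurable_fun setT (fun x : eball R d => g (sval x)).
Proof.
move=> /continuousP cg; apply: measurable_fun_eball => r.
by exists (g @^-1` [set t | t < r]) => //; apply: cg; exact: open_lt.
Qed.

Let dists x A := [set eucl_dist x a | a in A].

Let dists_lbound x A : lbound (dists x A) 0.
Proof. by move=> _ [a _ <-]; exact: enorm_ge0. Qed.

Lemma dist_set_ge0 x A : 0 <= dist_set x A.
Proof.
have [->|/set0P[a Aa]] := eqVneq A set0.
  by rewrite /dist_set image_set0 inf0.
by apply: lb_le_inf; [exists (eucl_dist x a), a|exact: dists_lbound].
Qed.

Lemma dist_set_le x A a : A a -> dist_set x A <= eucl_dist x a.
Proof. by move=> Aa; apply: ge_inf; [exists 0; exact: dists_lbound|exists a]. Qed.

Lemma eucl_dist_le2 x a : eucl_dist x a <= 2.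
Proof.
have := enormD (sval x) (- sval a); rewrite enormN /eucl_dist.
by have := svalP x; have := svalP a; lra.
Qed.

Lemma dist_set_le2 x A : dist_set x A <= 2.
Proof.
have [->|/set0P[a Aa]] := eqVneq A set0.
  by rewrite /dist_set image_set0 inf0.
exact: le_trans (dist_set_le x Aa) (eucl_dist_le2 x a).
Qed.

(** For nonempty [A], a strict sublevel set is the trace of a union of open balls centred in [A],
    and any such union is open. *)
Lemma measurable_dist_set A : measurable_fun setT (fun x => dist_set x A).
Proof.
have [->|/set0P[a0 Aa0]] := eqVneq A set0.
  rewrite (_ : (fun x => dist_set x set0) = cst 0); first exact: measurable_cst.
  by apply/funext => x; rewrite /dist_set image_set0 inf0.
apply: measurable_fun_eball => r.
exists (\bigcup_(a in A) [set y | enorm (y - sval a) < r]).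
  by apply: bigcup_open => a _; exact: open_enorm_ball.
move=> x; split=> [xr|[a Aa]].
  have infA : dists x A !=set0 by exists (eucl_dist x a0), a0.
  have [_ [a Aa <-]] := inf_lt infA xr.
  by exists a.
exact: le_lt_trans (dist_set_le x Aa).
Qed.

End unit_ball.

(** * Noise distance and sign of the labelling *)

Section noise_distance.
Variables (R : realType) (d : nat) (eta : eball R d -> R).
Implicit Types x z : eball R d.

Lemma tau_ge0 x : 0 <= tau eta x.
Proof. by rewrite /tau; case: ifP => _; [|case: ifP => _]; rewrite ?dist_set_ge0. Qed.

(** Together with [enorm x <= 1] this confines the ball of radius [tau eta x] around [x] to the cube
    of half-width 3; a distance to the empty set counts as 0. *)
Lemma tau_le2 x : tau eta x <= 2.
Proof. by rewrite /tau; case: ifP => _; [|case: ifP => _]; rewrite ?dist_set_le2. Qed.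

Lemma measurable_tau : measurable_fun setT eta -> measurable_fun setT (tau eta).
Proof.
move=> meta; rewrite (_ : tau eta = fun x => if eta x < 2^-1
    then dist_set x (Xzero eta `|` Xpos eta) else if 2^-1 < eta x
    then dist_set x (Xzero eta `|` Xneg eta) else 0).
  apply: measurable_fun_ifT; [|exact: measurable_dist_set|].
    by apply: measurable_fun_ltr => //; exact: measurable_cst.
  apply: measurable_fun_ifT; [|exact: measurable_dist_set|exact: measurable_cst].
  by apply: measurable_fun_ltr => //; exact: measurable_cst.
apply/funext => x; rewrite /tau /Xneg /Xpos.
have -> : (x \in [set x | eta x < 2^-1]) = (eta x < 2^-1).
  by apply/idP/idP; rewrite inE.
have -> // : (x \in [set x | 2^-1 < eta x]) = (2^-1 < eta x).
by apply/idP/idP; rewrite inE.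
Qed.

Definition sign_label x : R := Num.sg (2 * eta x - 1).

(** A point with a different sign belongs to the set from which [tau] measures the distance. *)
Lemma sign_label_near x z : eta x != 2^-1 -> eucl_dist x z < tau eta x ->
  sign_label z = sign_label x.
Proof.
move=> x0; rewrite /tau /sign_label; case: ifPn.
  rewrite inE /Xneg/= => xneg xz.
  have zneg : eta z < 2^-1.
    rewrite ltNge; apply/negP; rewrite le_eqVlt => zpos.
    have /(dist_set_le x) : (Xzero eta `|` Xpos eta) z.
      by case/orP: zpos => [/eqP ze|]; [left|right].
    by rewrite leNgt xz.
  by rewrite !ltr0_sg//; lra.
move=> _; case: ifPn; last by rewrite ltNge enorm_ge0.
rewrite inE /Xpos/= => xpos xz.
have zpos : 2^-1 < eta z.
  rewrite ltNge; apply/negP; rewrite le_eqVlt => zneg.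
  have /(dist_set_le x) : (Xzero eta `|` Xneg eta) z.
    by case/orP: zneg => [/eqP ze|]; [left|right].
  by rewrite leNgt xz.
by rewrite !gtr0_sg//; lra.
Qed.

End noise_distance.

(** The membership criterion is applied with [M] the squared norm of the combination on the whole
    space; its hypothesis is then the Cauchy-Schwarz inequality for the ambient Gaussian kernel. *)
Lemma gauss_restrict_mem (R : realType) (d : nat) (sigma : R)
    (H : hilbertFun R (eball R d)) (l : seq (R * 'rV[R]_d)) :
  is_rkhs (@gauss_kernel R d sigma) H ->
  let f := fun x : eball R d => kcomb (rV_gauss sigma) l (sval x) in
  hf_mem H f /\ hf_dot H f f <= kpair l (kcomb (rV_gauss sigma) l).
Proof.
move=> Hk f; apply: (rkhs_mem_of_bound Hk); first exact: psd_rV_gauss.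
move=> s; pose s' := [seq (p.1, sval p.2 : 'rV[R]_d) | p <- s].
have -> : kpair s f = kpair s' (kcomb (rV_gauss sigma) l).
  by rewrite /kpair big_map.
have -> : kpair s (kcomb (@gauss_kernel R d sigma) s) =
          kpair s' (kcomb (rV_gauss sigma) s').
  by rewrite /kpair /kcomb big_map; apply: eq_bigr => p _; rewrite big_map.
rewrite mulrC; apply: psd_cauchy_schwarz; last exact: psd_rV_gauss.
exact: rV_gaussC.
Qed.

Lemma rV_gauss_continuous (R : realType) (d : nat) (sigma : R) (y : 'rV[R]_d) :
  continuous (rV_gauss sigma y).
Proof.
rewrite (_ : rV_gauss sigma y = fun x =>
    expR (- (sigma ^+ 2 * (enorm (x - y) * enorm (x - y))))); last first.
  by apply/funext => x; rewrite /rV_gauss enormBC expr2.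
have gauss1_cont : continuous (fun t : R => expR (- (sigma ^+ 2 * (t * t)))).
  move=> t; apply: continuous_comp; last exact: continuous_expR.
  apply: cvgN; apply: cvgM; first exact: cvg_cst.
  by apply: cvgM; exact: cvg_id.
move=> x; exact: (continuous_comp (@enorm_continuous R d y x) (@gauss1_cont _)).
Qed.

Lemma kcomb_gauss_continuous (R : realType) (d : nat) (sigma : R)
  (l : seq (R * 'rV[R]_d)) : continuous (kcomb (rV_gauss sigma) l).
Proof.
rewrite (_ : kcomb _ l = fun x => \sum_(p <- l) p.1 * rV_gauss sigma p.2 x)//.
apply: continuous_big => [|p _ x]; first exact: add_continuous.
exact: (@continuousM _ _ (cst p.1) _ x (@cst_continuous _ _ _ _)
  (@rV_gauss_continuous _ _ _ _ x)).
Qed.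

Lemma ball_label_approx (R : realType) (d : nat) (sigma eps : R)
    (H : hilbertFun R (eball R d)) (eta : eball R d -> R) :
  0 < sigma -> 0 < eps -> is_rkhs (@gauss_kernel R d sigma) H ->
  exists f, [/\ hf_mem H f, measurable_fun setT f,
    hf_norm H f ^+ 2 <= (8 * expR 1 * sigma) ^+ d,
    forall x, `|f x| <= 1 &
    forall x, eta x != 2^-1 -> `|sign_label eta x - f x| <= eps +
      2 * gauss_tail_cst R d * expR (- (sigma ^+ 2 * tau eta x ^+ 2 / 2))].
Proof.
move=> sigma0 eps0 Hk.
pose box (y : 'rV[R]_d) := [forall i, `|y ord0 i| <= 3].
pose proj (y : 'rV[R]_d) : eball R d := exist _ (ball_proj y) (enorm_ball_proj y).
pose s y : R := if box y then sign_label eta (proj y) else 0.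
have sg1 x : `|sign_label eta x| <= 1.
  by rewrite /sign_label normr_sg; case: (_ == 0).
have s1 y : `|s y| <= 1 by rewrite /s; case: ifP => // _; rewrite normr0.
have s3 y : s y != 0 -> forall i, `|y ord0 i| <= 3.
  by rewrite /s; case: ifPn => [/forallP //|_]; rewrite eqxx.
have [l [lK l1 lb]] := gauss_approx sigma0 eps0 s1 s3.
have [fH fn] := gauss_restrict_mem l Hk.
exists (fun x => kcomb (rV_gauss sigma) l (sval x)); split => //.
- apply: measurable_continuous_eball; exact: kcomb_gauss_continuous.
- by rewrite sqr_sqrtr ?hf_dot_ge0// (le_trans fn).
move=> x x0; apply: lb => //; [exact: (svalP x)|exact: tau_ge0|].
move=> y yx; have yx2 := lt_le_trans yx (tau_le2 eta x).
(* Each coordinate of [y] is at most [2 + 1] in absolute value, so the cut-off is not active. *)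
have -> : s y = sign_label eta (proj y).
  rewrite /s ifT//; apply/forallP => i.
  have := coord_le_enorm (y - sval x) i; have := coord_le_enorm (sval x) i.
  have := svalP x; rewrite !mxE => x1 xi yi.
  have := ler_normD (y ord0 i - sval x ord0 i) (sval x ord0 i).
  by rewrite subrK; lra.
apply: (@sign_label_near _ _ eta) => //; apply: (le_lt_trans _ yx).
by rewrite enormBC; apply: ball_proj_contract; exact: (svalP x).
Qed.

(** * Excess hinge risk *)

Section density.
Local Open Scope ereal_scope.
Context d (T : measurableType d) (R : realType).
Variables (mu nu : {measure set T -> \bar R}) (g : T -> R).
Hypothesis mg : measurable_fun setT g.
Hypothesis g0 : forall x, (0 <= g x)%R.
Hypothesis nu_density : forall A, measurable A -> nu A = \int[mu]_(x in A) (g x)%:E.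

Import HBNNSimple.

(** Change of measure for a density: simple functions first, then monotone convergence on both
    sides. *)
Lemma integral_density (f : T -> \bar R) : measurable_fun setT f ->
  (forall x, 0 <= f x) -> \int[nu]_x f x = \int[mu]_x (f x * (g x)%:E).
Proof.
move=> mf f0; pose h := nnsfun_approx measurableT mf.
have mgE : measurable_fun setT (EFin \o g) by exact/measurable_EFinP.
have -> : \int[nu]_x f x = lim (\int[nu]_x (EFin \o h n) x @[n --> \oo]).
  have fE x : f x = lim ((EFin \o h n) x @[n --> \oo]).
    by apply/esym/cvg_lim => //; exact: cvg_nnsfun_approx.
  under eq_integral do rewrite fE.
  apply: monotone_convergence => //.
  - by move=> n; apply/measurable_EFinP; exact/measurable_funP.
  - by move=> n x _; rewrite lee_fin.
  - by move=> x _ a b ab; rewrite lee_fin; exact/lefP/nd_nnsfun_approx.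
have -> : \int[mu]_x (f x * (g x)%:E) =
    lim (\int[mu]_x ((EFin \o h n) \* (EFin \o g)) x @[n --> \oo]).
  have fg x : f x * (g x)%:E = lim (((EFin \o h n) \* (EFin \o g)) x @[n --> \oo]).
    apply/esym/cvg_lim => //; apply: cvgeZr => //.
    exact: cvg_nnsfun_approx.
  under eq_integral do rewrite fg.
  apply: monotone_convergence => //.
  - by move=> n; apply: emeasurable_funM => //; apply/measurable_EFinP.
  - by move=> n x _ /=; rewrite mule_ge0 ?lee_fin.
  - move=> x _ a b ab /=; rewrite lee_wpmul2r ?lee_fin//.
    exact/lefP/nd_nnsfun_approx.
suff suf n : \int[mu]_x ((EFin \o h n) x * (g x)%:E) =
    \int[nu]_x (EFin \o h n) x by under eq_fun do rewrite -suf.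
transitivity (\int[nu]_x (\sum_(y \in range (h n))
    (y * \1_(h n @^-1` [set y]) x)%:E)); last first.
  by apply: eq_integral => t _; rewrite /= fimfunE -fsumEFin.
have mind r : measurable_fun setT (fun x => (r * \1_(h n @^-1` [set r]) x)%:E).
  by apply/measurable_EFinP; exact: measurable_funM.
rewrite ge0_integral_fsum//; last by move=> y x _; exact: nnfun_muleindic_ge0.
transitivity (\int[mu]_x (\sum_(y \in range (h n))
    (y * \1_(h n @^-1` [set y]) x)%:E * (g x)%:E)).
  under [RHS]eq_integral => x _.
    rewrite -ge0_mule_fsuml => [|y]; last exact: nnfun_muleindic_ge0.
    rewrite fsumEFin // -(fimfunE _ x); over.
  by [].
rewrite ge0_integral_fsum//; last 2 first.
  - by move=> y; apply: emeasurable_funM.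
  - by move=> y x _; apply: mule_ge0; [exact: nnfun_muleindic_ge0|rewrite lee_fin].
apply: eq_fsbigr => r rhn.
have r0 : (0 <= r)%R by move: rhn; rewrite inE => -[t _ <-].
have mhr : measurable (h n @^-1` [set r]) by [].
under eq_integral do rewrite EFinM -muleA.
rewrite ge0_integralZl//; last 2 first.
- by apply: emeasurable_funM => //; apply/measurable_EFinP.
- by move=> t _; rewrite mule_ge0 ?lee_fin.
under [RHS]eq_integral do rewrite EFinM.
rewrite ge0_integralZl//; last first.
  by apply/measurable_EFinP.
congr (_ * _); rewrite integral_indic// setIT nu_density//.
rewrite [RHS]integral_mkcond; apply: eq_integral => x _.
by rewrite muleC epatch_indic.
Qed.

End density.

Section conditional_risk.
Variables (R : realType) (d : nat) (P : probability (eball R d * bool)%type R).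
Variable eta : eball R d -> R.
Hypothesis Peta : cond_prob_version P eta.
Local Open Scope ereal_scope.

Let meta : measurable_fun setT eta. Proof. by case: Peta. Qed.

Let eta01 x : (0 <= eta x <= 1)%R. Proof. by case: Peta. Qed.

Let slice (b : bool) : set (eball R d * bool) := setT `*` [set b].

Let mslice b : measurable (slice b).
Proof. by apply: measurableX. Qed.

Lemma marginal_false (A : set (eball R d)) : measurable A ->
  P (A `*` [set false]) = \int[pushforward P fst]_(x in A) (1 - eta x)%:E.
Proof.
move=> mA; have [_ _ PA] := Peta.
have mA1 b : measurable (A `*` [set b] : set (eball R d * bool)).
  by apply: measurableX.
have meta' : measurable_fun A eta by exact: measurable_funTS.
have split_A : pushforward P fst A = P (A `*` [set true]) + P (A `*` [set false]).
  rewrite -measureU//; last first.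
    by apply/seteqP; split => -[x b]//= [[_ ->] [_]].
  congr (P _); apply/seteqP; split => [[x [] Ax]|[x b] [[]|[]]]//.
    by left.
  by right.
have total : pushforward P fst A =
    \int[pushforward P fst]_(x in A) (eta x)%:E +
    \int[pushforward P fst]_(x in A) (1 - eta x)%:E.
  rewrite -ge0_integralD//.
  - under eq_integral do rewrite -EFinD addrC subrK.
    by rewrite integral_cst// mul1e.
  - by move=> x _; rewrite lee_fin; case/andP: (eta01 x).
  - exact/measurable_EFinP.
  - by move=> x _; rewrite lee_fin subr_ge0; case/andP: (eta01 x).
  - by apply/measurable_EFinP; apply: measurable_funB.
(* Finiteness of this integral permits cancelling it from the two decompositions of the marginal. *)
have Ifin : \int[pushforward P fst]_(x in A) (eta x)%:E \is a fin_num.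
  by rewrite -PA// fin_num_measure.
move: total; rewrite split_A PA// => /(congr1 (fun z =>
  z - \int[pushforward P fst]_(x in A) (eta x)%:E)).
by rewrite ![\int[_]_(x in A) (eta x)%:E + _]addeC !addeK.
Qed.

(** Two changes of measure: the restriction [Pb] of [P] to a slice has the indicator as density with
    respect to [P], and its image on the ball has density [eta] or [1 - eta] with respect to the
    marginal. *)
Lemma integral_slice b (h : eball R d -> R) : measurable_fun setT h ->
  (forall x, 0 <= h x)%R ->
  \int[P]_z ((h z.1)%:E * (\1_(slice b) z)%:E) =
  \int[pushforward P fst]_x
    ((h x)%:E * (if b then eta x else 1 - eta x)%:E).
Proof.
move=> mh h0; pose Pb := mrestr P (mslice b).
have mhE : measurable_fun setT (EFin \o h) by exact/measurable_EFinP.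
rewrite -(@integral_density _ _ _ P Pb (\1_(slice b)) _ _ _ (fun z => (h z.1)%:E))//.
- rewrite -(@ge0_integral_pushforward _ _ _ _ _ fst measurable_fst Pb setT (EFin \o h))//.
  apply: (@integral_density _ _ _ _ _ (fun x => if b then eta x else 1 - eta x)%R) => //.
  + by case: (b) => //; exact: measurable_funB.
  + by move=> x; case: (b); have := eta01 x => /andP[]; rewrite ?subr_ge0.
  + move=> A mA; transitivity (P (A `*` [set b])).
      change (P (fst @^-1` A `&` slice b) = P (A `*` [set b])); congr (P _).
      by apply/seteqP; split => -[x c]/=; [case=> ? []|case].
    by case: (b); [case: Peta => _ _ ->|rewrite marginal_false].
- by move=> x _; rewrite lee_fin.
- by move=> A mA; rewrite integral_indic// setIC.
- by apply: (measurableT_comp mhE); exact: measurable_fst.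
- by move=> z; rewrite lee_fin.
Qed.

Lemma hinge_ge0 y t : (0 <= hinge y t :> R)%R.
Proof. by rewrite /hinge le_max lexx. Qed.

Lemma measurable_hinge y (f : eball R d -> R) : measurable_fun setT f ->
  measurable_fun setT (fun x => hinge y (f x)).
Proof.
move=> mf; apply: measurable_maxr; first exact: measurable_cst.
by apply: measurable_funB => //; apply: measurable_funM.
Qed.

Lemma risk_cond (f : eball R d -> R) : measurable_fun setT f ->
  risk P f = \int[pushforward P fst]_x
    (eta x * hinge 1 (f x) + (1 - eta x) * hinge (-1) (f x))%:E.
Proof.
move=> mf; rewrite /risk unlock.
have mh y := measurable_hinge y mf.
transitivity (\int[P]_z ((hinge 1 (f z.1))%:E * (\1_(slice true) z)%:E +
    (hinge (-1)%R (f z.1))%:E * (\1_(slice false) z)%:E)).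
  apply: eq_integral => -[x b] _ /=; rewrite !indicE.
  have sliceE c : ((x, b) \in slice c) = (b == c).
    by apply/idP/eqP; rewrite inE /slice/=; [case|].
  by rewrite !sliceE; case: b {sliceE} => /=;
    rewrite ?mulr1n ?mulr0n mule1 mule0 ?adde0 ?add0e.
have mhE b y : measurable_fun setT (fun z : eball R d * bool =>
    (hinge y (f z.1))%:E * (\1_(slice b) z)%:E).
  apply: emeasurable_funM; last by apply/measurable_EFinP.
  apply/measurable_EFinP.
  exact: (measurableT_comp (mh y) measurable_fst).
rewrite (@ge0_integralD _ _ _ P setT _
  (fun z => (hinge 1 (f z.1))%:E * (\1_(slice true) z)%:E)
  (fun z => (hinge (-1)%R (f z.1))%:E * (\1_(slice false) z)%:E))//; last 2 first.
- by move=> z _; rewrite mule_ge0 ?lee_fin ?hinge_ge0.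
- by move=> z _; rewrite mule_ge0 ?lee_fin ?hinge_ge0.
rewrite (integral_slice true (mh 1%R) (fun x => hinge_ge0 _ _)).
rewrite (integral_slice false (mh (-1)%R) (fun x => hinge_ge0 _ _)).
have meta1 : measurable_fun setT (fun x => 1 - eta x)%R by exact: measurable_funB.
rewrite -ge0_integralD//.
- by apply: eq_integral => x _; rewrite !EFinD !EFinM muleC [in X in _ + X]muleC.
- move=> x _; rewrite mule_ge0 ?lee_fin ?hinge_ge0//.
  by case/andP: (eta01 x).
- by apply/measurable_EFinP; apply: measurable_funM.
- move=> x _; rewrite mule_ge0 ?lee_fin ?hinge_ge0// subr_ge0.
  by case/andP: (eta01 x).
- by apply/measurable_EFinP; apply: measurable_funM.
Qed.

End conditional_risk.

(** On [[-1, 1]] both hinge losses are affine and the left side equals [1 - (2 * e - 1) * t], while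
    no [u] gets below 1 minus the absolute value of [2 * e - 1]; the gap between the two is the last
    product. *)
Lemma cond_hinge_le (R : realType) (e t u : R) : 0 <= e <= 1 -> `|t| <= 1 ->
  e * hinge 1 t + (1 - e) * hinge (-1) t <=
  e * hinge 1 u + (1 - e) * hinge (-1) u +
    `|2 * e - 1| * `|Num.sg (2 * e - 1) - t|.
Proof.
move=> /andP[e0 e1]; rewrite ler_norml => /andP[t0 t1].
have -> : hinge 1 t = 1 - t by rewrite /hinge mul1r max_r//; lra.
have -> : hinge (-1) t = 1 + t by rewrite /hinge mulN1r opprK max_r//; lra.
have a0 : 0 <= hinge 1 u by exact: hinge_ge0.
have b0 : 0 <= hinge (-1) u by exact: hinge_ge0.
have a1 : 1 - u <= hinge 1 u by rewrite /hinge mul1r le_max lexx orbT.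
have b1 : 1 + u <= hinge (-1) u by rewrite /hinge mulN1r opprK le_max lexx orbT.
move: (hinge 1 u) (hinge (-1) u) a0 b0 a1 b1 => a b a0 b0 a1 b1.
have [e2|e2|e2] := ltgtP (2 * e - 1) 0.
- have st : `|-1 - t| = 1 + t by rewrite ler0_norm; lra.
  by rewrite ltr0_sg// st ltr0_norm//; nra.
- have st : `|1 - t| = 1 - t by rewrite ger0_norm; lra.
  by rewrite gtr0_sg// st gtr0_norm//; nra.
- by rewrite e2 normr0 mul0r addr0; nra.
Qed.

Section excess_risk.
Variables (R : realType) (d : nat) (P : probability (eball R d * bool)%type R).
Variable eta : eball R d -> R.
Hypothesis Peta : cond_prob_version P eta.
Local Open Scope ereal_scope.

Lemma excess_risk_le (f g h : eball R d -> R) (eps c : R) :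
  measurable_fun setT f -> measurable_fun setT g -> measurable_fun setT h ->
  (0 <= eps)%R -> (0 <= c)%R ->
  (forall x, `|f x| <= 1)%R -> (forall x, 0 <= h x)%R ->
  (forall x, `|2 * eta x - 1| * `|sign_label eta x - f x| <= eps + c * h x)%R ->
  risk P f <= risk P g + (eps%:E + c%:E * \int[pushforward P fst]_x (h x)%:E).
Proof.
move=> mf mg mh eps0 c0 f1 h0 fh; rewrite !(risk_cond Peta)//.
have [meta eta01 _] := Peta.
have meta1 : measurable_fun setT (fun x => 1 - eta x)%R by exact: measurable_funB.
have mL k : measurable_fun setT k -> measurable_fun setT
    (fun x => eta x * hinge 1 (k x) + (1 - eta x) * hinge (-1) (k x))%R.
  move=> mk; apply: measurable_funD.
    by apply: measurable_funM => //; exact: measurable_hinge.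
  by apply: measurable_funM => //; exact: measurable_hinge.
have L0 (k : eball R d -> R) x :
    (0 <= eta x * hinge 1 (k x) + (1 - eta x) * hinge (-1) (k x))%R.
  have /andP[e0 e1] := eta01 x.
  by rewrite addr_ge0// mulr_ge0 ?hinge_ge0// subr_ge0.
have mch : measurable_fun setT (fun x => (c * h x)%:E).
  by apply/measurable_EFinP; exact: measurable_funM.
have ch0 x : 0 <= (c * h x)%:E by rewrite lee_fin mulr_ge0.
have -> : eps%:E + c%:E * \int[pushforward P fst]_x (h x)%:E =
    \int[pushforward P fst]_x (eps%:E + (c * h x)%:E).
  rewrite ge0_integralD//.
  rewrite integral_cst// [X in eps%:E * X](_ : _ = 1) ?mule1; last first.
    exact: (probability_setT P).
  congr (_ + _).
  under [RHS]eq_integral do rewrite EFinM.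
  rewrite ge0_integralZl//; first exact/measurable_EFinP.
  by move=> x _; rewrite lee_fin.
rewrite -ge0_integralD//; last 4 first.
- by move=> x _; rewrite lee_fin.
- by apply/measurable_EFinP; exact: mL.
- by move=> x _; rewrite adde_ge0// lee_fin.
- by apply: emeasurable_funD.
apply: ge0_le_integral => //.
- by move=> x _; rewrite lee_fin.
- by apply/measurable_EFinP; exact: mL.
- apply: emeasurable_funD; first by apply/measurable_EFinP; exact: mL.
  exact: emeasurable_funD.
move=> x _; rewrite -!EFinD lee_fin.
apply: le_trans (cond_hinge_le (g x) (eta01 x) (f1 x)) _.
by rewrite lerD2l fh.
Qed.

Lemma risk_ge0 (f : eball R d -> R) : 0 <= risk P f.
Proof. by apply: expectation_ge0 => z; exact: hinge_ge0. Qed.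

(** The zero function has risk 1. Finiteness makes the subtraction in [approx_error] meaningful. *)
Lemma bayes_risk_fin : bayes_risk P \is a fin_num.
Proof.
rewrite ge0_fin_numE; last by apply: le_ereal_inf_tmp => _ [f _ <-]; exact: risk_ge0.
apply: (@le_lt_trans _ _ (risk P (fun _ => 0%R))); last first.
  rewrite /risk unlock; under eq_integral do rewrite /hinge mulr0 subr0 max_r//.
  by rewrite integral_cst// mul1e (le_lt_trans (probability_le1 _ _))// ltry.
by apply: ereal_inf_lbound; exists (fun _ => 0%R) => //; exact: measurable_cst.
Qed.

Lemma approx_error_le (H : hilbertFun R (eball R d)) (lambda : R)
    (f h : eball R d -> R) (eps c : R) : hf_mem H f ->
  measurable_fun setT f -> measurable_fun setT h ->
  (0 <= eps)%R -> (0 <= c)%R ->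
  (forall x, `|f x| <= 1)%R -> (forall x, 0 <= h x)%R ->
  (forall x, `|2 * eta x - 1| * `|sign_label eta x - f x| <= eps + c * h x)%R ->
  approx_error P H lambda <= (lambda * hf_norm H f ^+ 2)%:E +
    (eps%:E + c%:E * \int[pushforward P fst]_x (h x)%:E).
Proof.
move=> Hf mf mh eps0 c0 f1 h0 fh.
apply: (@le_trans _ _ ((lambda * hf_norm H f ^+ 2)%:E + risk P f - bayes_risk P)).
  by apply: ereal_inf_lbound; exists f.
rewrite -addeA leeD2l// leeBlDr ?bayes_risk_fin// addeC.
set B := eps%:E + _; have B0 : 0 <= B.
  apply: adde_ge0; first by rewrite lee_fin.
  apply: mule_ge0; first by rewrite lee_fin.
  apply: integral_ge0 => [|x _]; first exact: measurable_fst.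
  by rewrite lee_fin.
(* An infinite bound is trivial; a finite one is moved to the other side before the infimum over [g]
   is taken. *)
have [Bfin|] := boolP (B \is a fin_num); last first.
  rewrite ge0_fin_numE// -leNgt leye_eq => /eqP BE.
  have bN : bayes_risk P != -oo by move: bayes_risk_fin; rewrite fin_numE => /andP[].
  by rewrite BE addey// leey.
rewrite -leeBlDr//; apply: le_ereal_inf_tmp => _ [g mg <-].
by rewrite leeBlDr//; exact: excess_risk_le.
Qed.

End excess_risk.

(** * The noise condition applied to the smoothed labelling *)

Theorem theorem2p7 (R : realType) (d : nat) :
  exists c_d : R, 0 < c_d /\
    forall (sigma : R) (H : hilbertFun R (eball R d))
      (P : probability (eball R d * bool)%type R) (eta : eball R d -> R)
      (alpha C : R),
      0 < sigma ->
      is_rkhs (@gauss_kernel R d sigma) H ->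
      cond_prob_version P eta ->
      0 < alpha ->
      geometric_noise P eta alpha C ->
      forall lambda : R, 0 < lambda ->
        (approx_error P H lambda <=
          (c_d * (sigma ^+ d * lambda +
                  C * (2 * d%:R) `^ (alpha * d%:R / 2)
                    * sigma `^ (- (alpha * d%:R))))%:E)%E.
Proof.
pose K : R := (8 * expR 1) ^+ d; pose c : R := 2 * gauss_tail_cst R d.
have K0 : 0 < K by rewrite exprn_gt0// mulr_gt0// expR_gt0.
have c0 : 0 < c.
  by rewrite mulr_gt0// exprn_gt0// mulr_gt0 ?expR_gt0// addr_gt0// mulr_gt0 ?expR_gt0.
exists (K + c); split; first exact: addr_gt0.
move=> sigma H P eta alpha C sigma0 Hk Peta alpha0 noise lambda lambda0.
have [meta eta01 _] := Peta.
(* For [d = 0] the parameter [2 * d / sigma ^+ 2] would be 0; the maximum with 1 keeps [t] positive,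
   and in that case the powers in [tE] have exponent 0 and agree. *)
pose m : R := (maxn d 1)%:R.
have m1 : 1 <= m by rewrite ler1n leq_maxr.
pose t := 2 * m * sigma `^ (- 2).
have s2 : sigma `^ (- 2) = (sigma ^+ 2)^-1 by rewrite powRN powR_mulrn// ltW.
have ss0 : 0 < sigma ^+ 2 by rewrite exprn_gt0.
have m0 : 0 < m := lt_le_trans ltr01 m1.
have t0 : 0 < t by rewrite !mulr_gt0 ?powR_gt0.
have tE : t `^ (alpha * d%:R / 2) =
    (2 * d%:R) `^ (alpha * d%:R / 2) * sigma `^ (- (alpha * d%:R)).
  rewrite /t [LHS]powRM ?powR_ge0 ?mulr_ge0// ?(ltW m0)//.
  rewrite -powRrM; congr (_ * _ `^ _); last by field.
  rewrite /m; case: (d) => [|k]; first by rewrite !mulr0 mul0r !powRr0.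
  by rewrite (maxn_idPl _).
pose h x := `|2 * eta x - 1| * expR (- (tau eta x ^+ 2 / t)).
have h0 x : 0 <= h x by rewrite mulr_ge0 ?expR_ge0.
have mh : measurable_fun setT h.
  apply: measurable_funM.
    apply: measurableT_comp => //.
    by apply: measurable_funB => //; exact: measurable_funM.
  apply: measurableT_comp => //; apply: measurableT_comp => //.
  apply: measurable_funM => //; apply: measurable_funX.
  exact: measurable_tau.
have hC := noise t t0; rewrite -/h tE mulrA in hC.
set D := C * _ * _ in hC *.
(* Nonnegativity of [D] comes from the noise condition, as [D] bounds a nonnegative integral. *)
have D0 : 0 <= D.
  rewrite -lee_fin; apply: le_trans hC; apply: integral_ge0 => [|x _].
    exact: measurable_fst.
  by rewrite lee_fin h0.
(* The function [f] depends on [eps], but the constants [K] and [c] do not, so [eps] can be sent to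
   0. *)
apply/lee_addgt0Pr => eps eps0.
have [f [fH mf fn f1 fs]] := ball_label_approx eta sigma0 eps0 Hk.
have fh x : `|2 * eta x - 1| * `|sign_label eta x - f x| <= eps + c * h x.
  have [ex|ex] := eqVneq (eta x) 2^-1.
    rewrite (_ : 2 * eta x - 1 = 0) ?normr0 ?mul0r.
      by apply: addr_ge0; [exact: ltW|apply: mulr_ge0 => //; exact: ltW].
    by rewrite ex divff// subrr.
  have e1 : `|2 * eta x - 1| <= 1.
    by have := eta01 x; rewrite ler_norml => /andP[? ?]; apply/andP; split; lra.
  (* By the choice of [t], [tau ^+ 2 / t] is the exponent on the left divided by [m >= 1]. *)
  have tauE : expR (- (sigma ^+ 2 * tau eta x ^+ 2 / 2)) <=
      expR (- (tau eta x ^+ 2 / t)).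
    rewrite ler_expR lerN2 ler_pdivrMr// /t s2.
    rewrite (_ : _ * (2 * m / _) = tau eta x ^+ 2 * m).
      by rewrite ler_peMr ?sqr_ge0.
    by field; exact: lt0r_neq0.
  have := fs x ex; rewrite -/c /h; move: tauE e1 (normr_ge0 (2 * eta x - 1)).
  set E := expR _; set E' := expR _; set a := `|_|; set b := `|_|.
  move=> EE' a1 a0 bE.
  have : a * b <= a * (eps + c * E').
    by rewrite ler_wpM2l// (le_trans bE)// lerD2l ler_pM2l.
  have : a * eps <= eps by rewrite ler_piMl// ltW.
  by lra.
apply: le_trans (approx_error_le Peta lambda fH mf mh (ltW eps0) (ltW c0) f1 h0 fh) _.
apply: (@le_trans _ _ ((lambda * (K * sigma ^+ d))%:E + (eps%:E + c%:E * D%:E)))%E.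
  apply: leeD.
    by rewrite lee_fin ler_pM2l// (le_trans fn)// exprMn.
  by rewrite leeD2l// lee_wpmul2l// lee_fin ltW.
rewrite -EFinM -!EFinD lee_fin.
(* [K] stems from the norm and [c] from the Gaussian tail; the cross terms created by the common
   factor [K + c] are nonnegative. *)
have : 0 <= K * D by rewrite mulr_ge0// ltW.
have : 0 <= c * (sigma ^+ d * lambda).
  by rewrite !mulr_ge0 ?exprn_ge0// ltW.
by lra.
Qed.
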